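(* Let $(M,g)$ be a Riemann-Lorentz space with polar end $D^{\infty}$. Every polar point has an open neighbourhood such that, after replacing $M$ by this neighbourhood, the following holds. There exists a polar-normal vector field $N\in\mathfrak{X}(M)$, that is, a vector field $N$ transversal to $D^\infty$ with $\beta_N=0$. Moreover, if $\overline N\in\mathfrak{X}(M)$ is another polar-normal vector field, then $N$ and $\overline N$ are proportional along $D^\infty$ (i.e. $\overline N(x)\in\mathbb{R}N(x)$ for every $x\in D^\infty$); thus a canonical polar-normal direction is determined along $D^\infty$.
   Context: Riemann-Lorentz space with polar end: $M$ is a smooth manifold of dimension $m\ge 2$, $D^\infty\subset M$ is a nonempty closed subset, and $g$ is a smooth nondegenerate symmetric $(0,2)$-tensor field on $M-D^\infty$. The dual metric $g^*$ on $T^*(M-D^\infty)$ is $g^*(\alpha,\beta)=g(X_\alpha,X_\beta)$, where $g(X_\alpha,\cdot)=\alpha$. It is required that: (D1) $g^*$ extends smoothly to all of $M$ (extension still denoted $g^*$), and for every coframe $(\theta^1,\dots,\theta^m)$ on an open set $U$ meeting $D^\infty$ one has $U\cap D^\infty=\{x\in U:\det(g^*(\theta^a,\theta^b))|_x=0\}$ and $d_x\det(g^*(\theta^a,\theta^b))\neq0$ for all $x\in U\cap D^\infty$ (so $D^\infty$ is a hypersurface and the radical $\mathrm{Rad}_p(g^* )\subset T_p^*M$ is one-dimensional for $p\in D^\infty$); (D2) for every $p\in D^\infty$ the annihilator $\{X\in T_pM:\mu(X)=0\ \forall\mu\in \mathrm{Rad}_p(g^* )\}$ equals $T_pD^\infty$;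 (RL) every connected component of $M-D^\infty$ is either Riemannian or Lorentzian (one minus sign) for $g$. Points of $D^\infty$ are called polar points. A vector field $Z$ on $M$ is transversal to $D^\infty$ if $Z(x)\notin T_xD^\infty$ for all $x\in D^\infty$. $\mathfrak{X}(M)$ denotes the vector fields on $M$, and $\mathfrak{X}_M(D^\infty)$ the vector fields on $M$ whose restriction to $D^\infty$ is tangent to $D^\infty$. The dual connection on $M-D^\infty$ is $\square_AB(C)=g(\nabla_AB,C)$, with $\nabla$ the Levi-Civita connection of $g$. For $Z$ transversal to $D^\infty$, the 1-form $\beta_Z$ on $D^\infty$ is defined as follows: for $V\in\mathfrak{X}(D^\infty)$, choose (locally) $X\in\mathfrak{X}_M(D^\infty)$ with $X|_{D^\infty}=V$ and $g(X,Z)=0$ on $M-D^\infty$; then $(\square_ZZ)(X)/g(Z,Z)$ extends smoothly across $D^\infty$ and $\beta_Z(V)$ is the restriction of the extension to $D^\infty$ (independent of the choice of $X$). *)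

(* Defs.v *)
From mathcomp Require Import all_boot all_order all_algebra.
From mathcomp Require Import all_classical all_reals.
From mathcomp Require Import topology normedtype derive.

Set Implicit Arguments.
Unset Strict Implicit.
Unset Printing Implicit Defensive.

Import Order.TTheory GRing.Theory Num.Theory.
Import numFieldNormedType.Exports.

Local Open Scope classical_set_scope.
Local Open Scope ring_scope.

(* On a finite-dimensional V and an open set O this is the usual C^k: a C^(k+1)
   function is differentiable with all directional derivatives C^k, and
   conversely.  Only the germs of f at points of O matter. *)
Fixpoint Ck (R : realType) (V W : normedModType R) (k : nat)
    (O : set V) (f : V -> W) : Prop :=
  match k with
  | 0 => forall x, O x -> {for x, continuous f}
  | k'.+1 => (forall x, O x -> differentiable f x) /\
             (forall v, Ck k' O (fun x => 'D_v f x))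
  end.

Definition smooth (R : realType) (V W : normedModType R)
    (O : set V) (f : V -> W) : Prop := forall k, Ck k O f.

(* A manifold carries an arbitrary, not necessarily maximal, smooth atlas
   indexed by chart.  param c is the inverse of coord c on coord c @` dom c. *)
Record manifold (R : realType) (m : nat) := Manifold {
  carrier :> topologicalType;
  chart : Type;
  dom : chart -> set carrier;
  coord : chart -> carrier -> 'rV[R]_m;
  param : chart -> 'rV[R]_m -> carrier;
  carrier_hausdorff : hausdorff_space carrier;
  carrier_second_countable : @second_countable carrier;
  dom_cover : forall x, exists c, dom c x;
  dom_open : forall c, open (dom c);
  coord_open : forall c, open (coord c @` dom c);
  coordK : forall c x, dom c x -> param c (coord c x) = x;
  coord_continuous : forall c x, dom c x -> {for x, continuous (coord c)};
  param_continuous : forall c x, dom c x ->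
    {for coord c x, continuous (param c)};
  transition_smooth : forall c c',
    smooth (coord c @` (dom c `&` dom c')) (coord c' \o param c)
}.

Arguments dom {R m M} : rename.
Arguments coord {R m M} : rename.
Arguments param {R m M} : rename.

Section Fields.
Context (R : realType) (m : nat) (M : manifold R m).
Implicit Types (U W D : set M) (c : chart M) (x : M).

(* Tensors are given by their components in each chart, related by the usual
   transformation laws; a vector at x has components v : 'rV_m in each chart
   containing x.  X c x is meaningful only for x in dom c. *)
Definition vfield := chart M -> M -> 'rV[R]_m.
Definition bfield := chart M -> M -> 'M[R]_m.

(* Vectors transform by v' = v *m transition c c' x. *)
Definition transition c c' x : 'M[R]_m :=
  jacobian (coord c' \o param c) (coord c x).

Definition smooth_comp (V : normedModType R) U (T : chart M -> M -> V) : Prop :=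
  forall c, smooth (coord c @` (U `&` dom c)) (T c \o param c).

Definition smooth_fun U (f : M -> R) : Prop := smooth_comp U (fun _ => f : M -> R^o).

Definition vector_field U (X : vfield) : Prop :=
  smooth_comp U X /\
  forall c c' x, U x -> dom c x -> dom c' x ->
    X c' x = X c x *m transition c c' x.

Definition one_form U (th : vfield) : Prop :=
  smooth_comp U th /\
  forall c c' x, U x -> dom c x -> dom c' x ->
    th c x = th c' x *m (transition c c' x)^T.

Definition tensor02 U (g : bfield) : Prop :=
  smooth_comp U g /\
  forall c c' x, U x -> dom c x -> dom c' x ->
    g c x = transition c c' x *m g c' x *m (transition c c' x)^T.

Definition tensor20 U (h : bfield) : Prop :=
  smooth_comp U h /\
  forall c c' x, U x -> dom c x -> dom c' x ->
    h c' x = (transition c c' x)^T *m h c x *m transition c c' x.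

Definition bil (G : 'M[R]_m) (u v : 'rV[R]_m) : R := (u *m G *m v^T) 0 0.

Definition pairing (mu v : 'rV[R]_m) : R := (mu *m v^T) 0 0.

Definition symmetric_on U (g : bfield) : Prop :=
  forall c x, U x -> dom c x -> forall u v, bil (g c x) u v = bil (g c x) v u.

Definition nondegenerate_on U (g : bfield) : Prop :=
  forall c x, U x -> dom c x ->
    forall u, (forall v, bil (g c x) u v = 0) -> u = 0.

(* The derivative of T at x in the direction with components v in chart c. *)
Definition dir (V : normedModType R) c (T : M -> V) x (v : 'rV[R]_m) : V :=
  'D_v (T \o param c) (coord c x).

Definition bil_fun (g : bfield) (X Y : vfield) c : M -> R^o :=
  fun y => bil (g c y) (X c y) (Y c y).

Definition lie_bracket (X Y : vfield) : vfield :=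
  fun c x => dir c (Y c) x (X c x) - dir c (X c) x (Y c x).

(* v, in the components of chart c, is the velocity at x of a smooth curve
   lying in D. *)
Definition tangent_to D c x (v : 'rV[R]_m) : Prop :=
  exists (gamma : R -> M) (e : R),
    [/\ 0 < e, gamma 0 = x,
        forall t, `|t| < e -> D (gamma t) /\ dom c (gamma t),
        smooth [set t : R^o | `|t| < e] (coord c \o gamma : R^o -> 'rV[R]_m) &
        derive1 (coord c \o gamma) 0 = v].

Definition eq_on U (X Y : vfield) : Prop :=
  forall c x, U x -> dom c x -> X c x = Y c x.

(* Operators act on fields defined on any open W `<=` U, so that nabla is also
   the Levi-Civita connection of the restriction of g to each such W. *)
Record levi_civita U (g : bfield) (nabla : vfield -> vfield -> vfield) : Prop :=
  LeviCivita {
  lc_field : forall W A B, open W -> W `<=` U ->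
    vector_field W A -> vector_field W B -> vector_field W (nabla A B);
  lc_addl : forall W A A' B, open W -> W `<=` U ->
    vector_field W A -> vector_field W A' -> vector_field W B ->
    eq_on W (nabla (fun c x => A c x + A' c x) B)
            (fun c x => nabla A B c x + nabla A' B c x);
  lc_scalel : forall W f A B, open W -> W `<=` U ->
    smooth_fun W f -> vector_field W A -> vector_field W B ->
    eq_on W (nabla (fun c x => f x *: A c x) B)
            (fun c x => f x *: nabla A B c x);
  lc_addr : forall W A B B', open W -> W `<=` U ->
    vector_field W A -> vector_field W B -> vector_field W B' ->
    eq_on W (nabla A (fun c x => B c x + B' c x))
            (fun c x => nabla A B c x + nabla A B' c x);
  lc_leibniz : forall W f A B, open W -> W `<=` U ->
    smooth_fun W f -> vector_field W A -> vector_field W B ->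
    eq_on W (nabla A (fun c x => f x *: B c x))
            (fun c x => dir c (f : M -> R^o) x (A c x) *: B c x
                        + f x *: nabla A B c x);
  lc_torsion_free : forall W A B, open W -> W `<=` U ->
    vector_field W A -> vector_field W B ->
    eq_on W (fun c x => nabla A B c x - nabla B A c x) (lie_bracket A B);
  lc_metric : forall W A B C, open W -> W `<=` U ->
    vector_field W A -> vector_field W B -> vector_field W C ->
    forall c x, W x -> dom c x ->
      dir c (bil_fun g B C c) x (A c x) =
      bil_fun g (nabla A B) C c x + bil_fun g B (nabla A C) c x
}.

Definition dual_connection (g : bfield) (nabla : vfield -> vfield -> vfield)
    (A B C : vfield) c : M -> R := bil_fun g (nabla A B) C c.

Definition coframe U (th : 'I_m -> vfield) : Prop :=
  (forall a, one_form U (th a)) /\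
  forall c x, U x -> dom c x -> row_free (\matrix_a th a c x).

Definition gram_det (gs : bfield) (th : 'I_m -> vfield) c : M -> R^o :=
  fun y => \det (\matrix_(a < m, b < m) bil (gs c y) (th a c y) (th b c y)).

(* g^*(alpha, beta) = g(X_alpha, X_beta), where g(X_alpha, .) = alpha. *)
Definition dual_metric U (g gs : bfield) : Prop :=
  forall c x, U x -> dom c x -> forall al be Xal Xbe : 'rV[R]_m,
    (forall v, bil (g c x) Xal v = pairing al v) ->
    (forall v, bil (g c x) Xbe v = pairing be v) ->
    bil (gs c x) al be = bil (g c x) Xal Xbe.

Definition radical (G : 'M[R]_m) : set 'rV[R]_m :=
  [set mu | forall nu, bil G mu nu = 0].

Definition riemannian (G : 'M[R]_m) : Prop := forall v, v != 0 -> 0 < bil G v v.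

(* There is a basis, the rows of P, that is orthonormal with one minus sign. *)
Definition lorentzian (G : 'M[R]_m) : Prop :=
  exists2 P : 'M[R]_m, P \in unitmx &
    P *m G *m P^T = diag_mx (\row_(i < m) (if val i == 0%N then -1 else 1)).

Record polar_end D (g gs : bfield) : Prop := PolarEnd {
  pe_nonempty : D !=set0;
  pe_closed : closed D;
  pe_tensor : tensor02 (~` D) g;
  pe_sym : symmetric_on (~` D) g;
  pe_nondegenerate : nondegenerate_on (~` D) g;
  pe_dual_tensor : tensor20 setT gs;
  pe_dual : dual_metric (~` D) g gs;
  pe_zero_set : forall U th, open U -> U `&` D !=set0 -> coframe U th ->
    forall c x, U x -> dom c x -> (D x <-> gram_det gs th c x = 0);
  pe_regular : forall U th, open U -> U `&` D !=set0 -> coframe U th ->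
    forall c x, U x -> dom c x -> D x ->
      exists v, dir c (gram_det gs th c) x v != 0;
  pe_radical : forall c x, D x -> dom c x -> forall v,
    (forall mu, radical (gs c x) mu -> pairing mu v = 0) <-> tangent_to D c x v;
  pe_riemann_lorentz : forall x, ~ D x ->
    let C := connected_component (~` D) x in
    (forall c y, C y -> dom c y -> riemannian (g c y)) \/
    (forall c y, C y -> dom c y -> lorentzian (g c y))
}.

Definition transversal D U (Z : vfield) : Prop :=
  forall c x, U x -> D x -> dom c x -> ~ tangent_to D c x (Z c x).

Definition tangent_vector_field D U (X : vfield) : Prop :=
  vector_field U X /\
  forall c x, U x -> D x -> dom c x -> tangent_to D c x (X c x).

(* Vector fields on the hypersurface U `&` D; only the values of V at points of
   U `&` D matter, and smoothness means local smooth extendability. *)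
Definition hypersurface_vector_field D U (V : vfield) : Prop :=
  (forall c x, U x -> D x -> dom c x -> tangent_to D c x (V c x)) /\
  forall x, U x -> D x -> exists W X,
    [/\ open W, W x, W `<=` U, vector_field W X & eq_on (W `&` D) V X].

Section Beta.
Context (D : set M) (g : bfield) (nabla : vfield -> vfield -> vfield).

(* beta_Z(V)(x) = b, for the restriction of the structure to U: W is the
   neighbourhood of x on which X is chosen and F is the smooth extension. *)
Definition beta_at U (Z V : vfield) x (b : R) : Prop :=
  exists (W : set M) (X : vfield) (F : M -> R),
    [/\ open W, W x, W `<=` U & tangent_vector_field D W X] /\
    [/\ eq_on (W `&` D) X V,
        forall c y, W y -> ~ D y -> dom c y -> bil_fun g X Z c y = 0,
        forall c y, W y -> ~ D y -> dom c y ->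
          bil_fun g Z Z c y != 0 /\
          F y = dual_connection g nabla Z Z X c y / bil_fun g Z Z c y,
        smooth_fun W F & F x = b].

(* beta_Z = b as 1-forms on U `&` D. *)
Definition beta_form U (Z : vfield) (b : vfield -> M -> R) : Prop :=
  forall V, hypersurface_vector_field D U V ->
    forall x, U x -> D x -> beta_at U Z V x (b V x).

Definition polar_normal U (N : vfield) : Prop :=
  [/\ vector_field U N, transversal D U N & beta_form U N (fun _ _ => 0)].

End Beta.

End Fields.

(* Main.v *)
(* Write G for the dual metric.  Near a polar point let tau = det G in a chart
   and sigma = tau / b, where b is the derivative of tau along
   Y = G(d tau) / tau.  Condition (D2) makes G(d tau) vanish on D, so Y is
   smooth by Hadamard division, and N = G(d sigma) / sigma, the gradient of
   ln sigma, is smooth with N sigma = 1 on D.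
   For a field Z write g(Z, .) = zeta (d sigma) / sigma + eta with zeta, eta
   smooth.  The Koszul formula shows that beta_Z is
   eta / (2 zeta) + (d ln (Z sigma) - d ln zeta) / 2 on vectors tangent to D.
   For Z = N one has zeta = 1, eta = 0 and N sigma = 1 on D, hence beta_N = 0.
   For general transversal Z take zeta = Z sigma; then Z - zeta N = G(eta) is
   tangent to D along D, and beta_Z = 0 forces eta to annihilate TD, i.e. eta
   lies in the radical and Z = zeta N on D. *)

From HB Require Import structures.
From mathcomp Require Import all_boot all_order all_algebra.
From mathcomp Require Import all_classical all_reals.
From mathcomp Require Import topology normedtype landau derive.
From mathcomp Require Import ring lra.
Require Import Defs.

Set Implicit Arguments.
Unset Strict Implicit.
Unset Printing Implicit Defensive.

Import Order.TTheory GRing.Theory Num.Theory.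
Import numFieldNormedType.Exports.
Local Open Scope classical_set_scope.
Local Open Scope ring_scope.

(** * Calculus of smooth maps *)

Section Calculus.
Context {R : realType}.
Implicit Types (V W : normedModType R).

(** The obstacle is division by [tau], since smoothness is defined by iterated directional
    derivatives. The hypersurface is never straightened. Instead, the quotients [w / tau ^ m], with
    [w] vanishing to order [m], form a class closed under directional derivatives, so continuity and
    one differentiability statement give all orders. Only a direction [e] with nonzero [D_e tau] is
    needed. The function [b] has no zero on D because [Y adj(G) = d tau] there, while [adj(G)] kills
    every vector tangent to D. The factor [1 / b] is forced: for [sigma = tau u] the rescaled
    gradient is [N = Y + G(du) / u], and on D one gets [N sigma = u d tau(Y) = u b], because
    [d tau(G(du)) = 0] there. The metric [g] is available only off D, where it is the inverse of
    [G]. Identities are proved there and carried across by density, and density also identifies any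
    two smooth extensions of the quotient defining [beta_Z]. *)

Lemma diff_eps V W (f : V -> W) (df : {linear V -> W}) x : continuous df ->
  (forall e, 0 < e -> \forall h \near 0, `|f (h + x) - f x - df h| <= e * `|h|) ->
  differentiable f x /\ 'd f x = df :> (V -> W).
Proof.
move=> dfc H.
have E : f \o shift x = cst (f x) + df +o_ 0 id.
  apply/eqaddoP => e e0; near=> h; rewrite !fctE /= opprD addrA.
  near: h; exact: H.
have E' := diff_unique dfc E; split=> //.
by apply/diff_locallyP; rewrite E'.
Unshelve. all: by end_near. Qed.

Lemma differentiable_eps V W (f : V -> W) x e : differentiable f x -> 0 < e ->
  \forall h \near 0, `|f (h + x) - f x - 'd f x h| <= e * `|h|.
Proof.
move=> /diff_locally /eqaddoP H e0; have := H e e0.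
by apply: filterS => h; rewrite !fctE /= opprD addrA.
Qed.

Lemma near_differentiable V W (f g : V -> W) x :
  (\near x, f x = g x) -> differentiable f x -> differentiable g x.
Proof.
move=> fg df.
have fgx := nbhs_singleton fg.
apply: (@diff_eps _ _ g ('d f x) x _ _).1; first exact: diff_continuous.
move=> e e0; have H := differentiable_eps df e0.
have fg' : \forall h \near 0, f (h + x) = g (h + x).
  by move: fg; rewrite (near_shift 0); apply: filterS => h /=; rewrite subr0.
by near=> h; rewrite -fgx -(near fg' h) //; near: h.
Unshelve. all: by end_near. Qed.

Lemma near_open (T : topologicalType) (O P : set T) x :
  open O -> O x -> O `<=` P -> \near x, P x.
Proof. by move=> oO Ox OP; apply: filterS OP _; exact: open_nbhs_nbhs. Qed.

Lemma Ck_eq V W k (O : set V) (f g : V -> W) : open O ->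
  (forall x, O x -> f x = g x) -> Ck k O f -> Ck k O g.
Proof.
move=> oO; elim: k f g => [|k IH] f g fg /=.
  move=> cf x Ox; have fgx : \near x, f x = g x := near_open oO Ox fg.
  have : f y @[y --> x] --> f x by exact: cf.
  rewrite (fg x Ox) => /(cvg_trans _); apply.
  exact: near_eq_cvg.
move=> [df Df]; split=> [x Ox|v].
  exact: near_differentiable (near_open oO Ox fg) (df x Ox).
by apply: IH (Df v) => x Ox; exact: near_eq_derive (near_open oO Ox fg).
Qed.

Lemma Ck_sub V W k (O U : set V) (f : V -> W) : U `<=` O ->
  Ck k O f -> Ck k U f.
Proof.
move=> OU; elim: k f => [|k IH] f /=; first by move=> H x /OU/H.
by move=> [H1 H2]; split=> [x /OU/H1//|v]; apply: IH.
Qed.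

Lemma CkW V W k (O : set V) (f : V -> W) : Ck k.+1 O f -> Ck k O f.
Proof.
elim: k f => [|k IH] f [H1 H2].
  by move=> x /H1; exact: differentiable_continuous.
by split=> // v; apply/IH/H2.
Qed.

Lemma Ck_cst V W k (O : set V) (a : W) : Ck k O (fun=> a).
Proof.
elim: k a => [|k IH] a /=; first by move=> x _; exact: cvg_cst.
split=> [x _|v]; first exact: differentiable_cst.
have -> : (fun x => 'D_v (fun=> a) x) = fun=> (0 : W); last exact: IH.
by apply/funext => x; exact: derive_cst.
Qed.

Lemma CkD V W k (O : set V) (f g : V -> W) : open O ->
  Ck k O f -> Ck k O g -> Ck k O (fun x => f x + g x).
Proof.
move=> oO; elim: k f g => [|k IH] f g /=.
  by move=> cf cg x Ox; apply: cvgD; [exact: cf|exact: cg].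
move=> [df Df] [dg Dg]; split=> [x Ox|v].
  by apply: differentiableD; [exact: df|exact: dg].
apply: (@Ck_eq _ _ _ _ (fun x => 'D_v f x + 'D_v g x)) => //.
  move=> x Ox; rewrite (_ : (fun x => f x + g x) = f + g)//.
  by rewrite deriveD//; apply: diff_derivable; [exact: df|exact: dg].
exact: IH.
Qed.

Lemma Ck_sum V W k (O : set V) (I : Type) (r : seq I) (P : pred I)
    (f : I -> V -> W) : open O -> (forall i, P i -> Ck k O (f i)) ->
  Ck k O (fun x => \sum_(i <- r | P i) f i x).
Proof.
move=> oO H; elim: r => [|i r IH].
  by rewrite (_ : (fun x => _) = fun=> 0); [exact: Ck_cst|apply/funext => x; rewrite big_nil].
case Pi : (P i); last first.
  by rewrite (_ : (fun x => _) = fun x => \sum_(i <- r | P i) f i x)//;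
    apply/funext => x; rewrite big_cons Pi.
rewrite (_ : (fun x => _) = fun x => f i x + \sum_(i <- r | P i) f i x).
  by apply: CkD => //; exact: H.
by apply/funext => x; rewrite big_cons Pi.
Qed.

Lemma CkM V k (O : set V) (f g : V -> R^o) : open O ->
  Ck k O f -> Ck k O g -> Ck k O (fun x => f x * g x : R^o).
Proof.
move=> oO; elim: k f g => [|k IH] f g.
  by move=> /= cf cg x Ox; apply: cvgM; [exact: cf|exact: cg].
move=> cf cg; have /CkW cf' := cf; have /CkW cg' := cg.
case: cf cg => df Df [dg Dg]; split=> [x Ox|v].
  by apply: differentiableM; [exact: df|exact: dg].
apply: (@Ck_eq _ _ _ _ (fun x => f x * 'D_v g x + g x * 'D_v f x : R^o)) => //.
  move=> x Ox; rewrite (_ : (fun x => f x * g x) = f * g)//.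
  by rewrite deriveM//; apply: diff_derivable; [exact: df|exact: dg].
by apply: CkD => //; apply: IH => //; [exact: Dg|exact: Df].
Qed.

(** The derivative is [- (1/f)^2 D_v f], so the induction hypothesis for [1/f] itself closes the
    step. *)
Lemma CkV V k (O : set V) (f : V -> R^o) : open O ->
  (forall x, O x -> f x != 0) ->
  Ck k O f -> Ck k O (fun x => (f x)^-1 : R^o).
Proof.
move=> oO f0; elim: k => [|k IH].
  by move=> /= cf x Ox; apply: cvgV; [exact: f0|exact: cf].
move=> cf; have /CkW cf' := cf.
case: cf => df Df; split=> [x Ox|v].
  by apply: differentiableV; [exact: df|exact: f0].
apply: (@Ck_eq _ _ _ _ (fun x => (-1) * ((f x)^-1 * (f x)^-1 * 'D_v f x) : R^o)) => //.
  move=> x Ox.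
  rewrite deriveV//; [|exact: f0|exact/diff_derivable/df].
  by rewrite /GRing.scale /= expr2 invfM mulN1r mulNr.
apply: CkM => //; first exact: Ck_cst.
apply: CkM => //; last exact: Df.
by apply: CkM => //; apply: IH.
Qed.

End Calculus.

(** * Smooth matrix-valued maps *)

Section MatrixCalculus.
Context {R : realType}.
Implicit Types (V W : normedModType R).

Lemma differentiable_mx V m n (F : V -> 'M[R]_(m, n)) x :
  (forall i j, differentiable (fun y => F y i j : R^o) x) -> differentiable F x.
Proof.
move=> dF.
have -> : F = \sum_(i < m) \sum_(j < n) (fun y => F y i j *: delta_mx i j).
  apply/funext => y; rewrite fct_sumE {1}[F y]matrix_sum_delta.
  by apply: eq_bigr => i _; rewrite fct_sumE.
apply: differentiable_sum => i; apply: differentiable_sum => j.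
exact: differentiableZl.
Qed.

Lemma differentiable_entry V m n (F : V -> 'M[R]_(m, n)) x i j :
  differentiable F x -> differentiable (fun y => F y i j : R^o) x.
Proof.
move=> dF.
exact: (differentiable_comp (g := fun N : 'M[R]_(m, n) => N i j : R)) dF
  (differentiable_coord _ _ _).
Qed.

Lemma derive_entry V m n (F : V -> 'M[R]_(m, n)) x v i j :
  differentiable F x -> ('D_v F x) i j = 'D_v (fun y => F y i j : R^o) x.
Proof. by move=> dF; rewrite derive_mx ?mxE//; exact: diff_derivable. Qed.

Lemma Ck_entry V m n k (O : set V) (F : V -> 'M[R]_(m, n)) i j : open O ->
  Ck k O F -> Ck k O (fun x => F x i j : R^o).
Proof.
move=> oO; elim: k F => [|k IH] F.
  move=> /= cF x Ox; have cFx : F y @[y --> x] --> F x by exact: cF.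
  exact: (@cvg_comp _ _ _ F (fun N : 'M_(m, n) => N i j) _ _ _ cFx
    (@matrix_normedtype.coord_continuous _ _ _ i j (F x))).
move=> [dF DF]; split=> [x Ox|v].
  by apply: differentiable_entry; exact: dF.
apply: (@Ck_eq _ _ _ _ _ (fun x => ('D_v F x) i j : R^o)) => //.
  by move=> x Ox; apply: derive_entry; exact: dF.
by apply: IH; exact: DF.
Qed.

Lemma Ck_mx V m n k (O : set V) (F : V -> 'M[R]_(m, n)) : open O ->
  (forall i j, Ck k O (fun x => F x i j : R^o)) -> Ck k O F.
Proof.
move=> oO; elim: k F => [|k IH] F CF.
  move=> x Ox; apply/cvgrPdist_lt => /= e e0.
  have H : \forall y \near x, forall ij : 'I_m * 'I_n, `|F x ij.1 ij.2 - F y ij.1 ij.2| < e.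
    apply: filter_forall => -[i j] /=.
    have cFx : (F y i j : R^o) @[y --> x] --> (F x i j : R^o) by exact: CF.
    by move/cvgrPdist_lt: cFx => /(_ e e0).
  apply: filterS H => y H.
  rewrite [ltLHS]/Num.Def.normr/= mx_normrE bigmax_lt// => ij _.
  by rewrite !mxE; exact: H.
split=> [x Ox|v].
  by apply: differentiable_mx => i j; exact: (CF i j).1.
apply: IH => i j; have [dF DF] := CF i j.
apply: (@Ck_eq _ _ _ _ _ _ _ oO _ (DF v)) => x Ox.
by rewrite derive_entry//; apply: differentiable_mx => i' j'; exact: (CF i' j').1.
Qed.

Lemma derive_sum_delta W n (f : 'rV[R]_n -> W) a v : differentiable f a ->
  'D_v f a = \sum_i v 0 i *: 'D_(delta_mx 0 i) f a.
Proof.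
move=> df; rewrite deriveE// {1}[v]row_sum_delta linear_sum.
by apply: eq_bigr => i _; rewrite linearZ deriveE.
Qed.

Lemma derive_comp V V' W (g : V -> V') (f : V' -> W) x v :
  differentiable g x -> differentiable f (g x) ->
  'D_v (f \o g) x = 'D_('D_v g x) f (g x).
Proof.
move=> dg df; rewrite deriveE; last exact: differentiable_comp.
by rewrite diff_comp//= -!deriveE.
Qed.

(** The chain rule differentiates [f] in the moving direction ['D_v g x], to which the induction
    hypothesis does not apply. Expanding that direction in the standard basis leaves fixed
    directions with coefficients of class C^k. *)
Lemma Ck_comp V n k (O : set V) (U : set 'rV[R]_n) (g : V -> 'rV[R]_n)
    (f : 'rV[R]_n -> R^o) : open O -> (forall x, O x -> U (g x)) ->
  Ck k O g -> Ck k U f -> Ck k O (fun x => f (g x)).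
Proof.
move=> oO gOU; elim: k f => [|k IH] f.
  move=> cg cf x Ox.
  have cgx : g y @[y --> x] --> g x by exact: cg.
  exact: (@cvg_comp _ _ _ g f _ _ _ cgx (cf _ (gOU _ Ox))).
move=> cg; have /CkW cg' := cg; case: cg => dg Dg [df Df]; split=> [x Ox|v].
  by apply: (differentiable_comp (dg _ Ox)); exact/df/gOU.
apply: (@Ck_eq _ _ _ _ _
    (fun x => \sum_i (('D_v g x) 0 i * 'D_(delta_mx 0 i) f (g x) : R^o))) => //.
  move=> x Ox; rewrite (_ : (fun x => f (g x)) = f \o g)//.
  have dgx := dg x Ox; have dfx := df _ (gOU x Ox).
  by rewrite (derive_comp v dgx dfx) (derive_sum_delta _ dfx).
apply: Ck_sum => // i _; apply: CkM => //; first exact/Ck_entry/Dg.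
exact: (IH (fun y => 'D_(delta_mx 0 i) f y) cg' (Df _)).
Qed.

Lemma Ck_coord n k (O : set 'rV[R]_n) i j : Ck k O (fun x => x i j : R^o).
Proof.
case: k => [|k]; first by move=> x _; exact: matrix_normedtype.coord_continuous.
split=> [x _|v]; first exact: differentiable_coord.
have -> : (fun x => 'D_v (fun x : 'rV_n => x i j : R^o) x) = fun=> (v i j : R^o).
  by apply/funext => x; rewrite -(@derive_entry _ _ _ id)// derive_id.
exact: Ck_cst.
Qed.

Lemma smooth_eq V W (O : set V) (f g : V -> W) : open O ->
  (forall x, O x -> f x = g x) -> smooth O f -> smooth O g.
Proof. by move=> oO fg sf k; exact: Ck_eq fg (sf k). Qed.

Lemma smooth_sub V W (O U : set V) (f : V -> W) : U `<=` O ->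
  smooth O f -> smooth U f.
Proof. by move=> UO sf k; exact: Ck_sub UO (sf k). Qed.

Lemma smooth_continuous V W (O : set V) (f : V -> W) x :
  smooth O f -> O x -> f y @[y --> x] --> f x.
Proof. by move=> sf; exact: (sf 0%N). Qed.

Lemma smooth_differentiable V W (O : set V) (f : V -> W) x :
  smooth O f -> O x -> differentiable f x.
Proof. by move=> sf; exact: (sf 1%N).1. Qed.

Lemma smooth_derivable V W (O : set V) (f : V -> W) x v :
  smooth O f -> O x -> derivable f x v.
Proof. by move=> sf Ox; apply: diff_derivable; exact: smooth_differentiable sf Ox. Qed.

Lemma smooth_derive V W (O : set V) (f : V -> W) v :
  smooth O f -> smooth O (fun x => 'D_v f x).
Proof. by move=> sf k; exact: (sf k.+1).2. Qed.

Lemma smooth_cst V W (O : set V) (a : W) : smooth O (fun=> a).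
Proof. by move=> k; exact: Ck_cst. Qed.

Lemma smoothD V W (O : set V) (f g : V -> W) : open O ->
  smooth O f -> smooth O g -> smooth O (fun x => f x + g x).
Proof. by move=> oO sf sg k; exact: CkD. Qed.

Lemma smooth_sum V W (O : set V) (I : Type) (r : seq I) (P : pred I)
    (f : I -> V -> W) : open O -> (forall i, P i -> smooth O (f i)) ->
  smooth O (fun x => \sum_(i <- r | P i) f i x).
Proof. by move=> oO sf k; apply: Ck_sum => // i Pi; exact: sf. Qed.

Lemma smoothM V (O : set V) (f g : V -> R^o) : open O ->
  smooth O f -> smooth O g -> smooth O (fun x => f x * g x : R^o).
Proof. by move=> oO sf sg k; exact: CkM. Qed.

Lemma smoothN V (O : set V) (f : V -> R^o) : open O ->
  smooth O f -> smooth O (fun x => - f x : R^o).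
Proof.
move=> oO sf; apply: (@smooth_eq _ _ _ (fun x => (-1) * f x : R^o)) => //.
  by move=> x _; rewrite mulN1r.
by apply: smoothM => //; exact: smooth_cst.
Qed.

Lemma smoothB V (O : set V) (f g : V -> R^o) : open O ->
  smooth O f -> smooth O g -> smooth O (fun x => f x - g x : R^o).
Proof. by move=> oO sf sg; apply: smoothD => //; exact: smoothN. Qed.

Lemma smoothV V (O : set V) (f : V -> R^o) : open O ->
  (forall x, O x -> f x != 0) ->
  smooth O f -> smooth O (fun x => (f x)^-1 : R^o).
Proof. by move=> oO f0 sf k; exact: CkV. Qed.

Lemma smooth_div V (O : set V) (f g : V -> R^o) : open O ->
  (forall x, O x -> g x != 0) ->
  smooth O f -> smooth O g -> smooth O (fun x => f x / g x : R^o).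
Proof. by move=> oO g0 sf sg; apply: smoothM => //; exact: smoothV. Qed.

Lemma smooth_prod V (O : set V) (I : Type) (r : seq I) (f : I -> V -> R^o) :
  open O -> (forall i, smooth O (f i)) ->
  smooth O (fun x => \prod_(i <- r) f i x : R^o).
Proof.
move=> oO sf; elim: r => [|i r IH].
  apply: (@smooth_eq _ _ _ (fun=> 1 : R^o)) => //; last exact: smooth_cst.
  by move=> x _; rewrite big_nil.
apply: (@smooth_eq _ _ _ (fun x => f i x * \prod_(j <- r) f j x : R^o)) => //.
  by move=> x _; rewrite big_cons.
exact: smoothM.
Qed.

Lemma smooth_entry V m n (O : set V) (F : V -> 'M[R]_(m, n)) i j : open O ->
  smooth O F -> smooth O (fun x => F x i j : R^o).
Proof. by move=> oO sF k; exact: Ck_entry. Qed.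

Lemma smooth_mx V m n (O : set V) (F : V -> 'M[R]_(m, n)) : open O ->
  (forall i j, smooth O (fun x => F x i j : R^o)) -> smooth O F.
Proof. by move=> oO sF k; apply: Ck_mx => // i j; exact: sF. Qed.

Lemma smooth_mulmx V m n p (O : set V) (F : V -> 'M[R]_(m, n))
    (G : V -> 'M[R]_(n, p)) : open O ->
  smooth O F -> smooth O G -> smooth O (fun x => F x *m G x).
Proof.
move=> oO sF sG; apply: smooth_mx => // i j.
apply: (@smooth_eq _ _ _ (fun x => \sum_k (F x i k * G x k j : R^o))) => //.
  by move=> x _; rewrite mxE.
by apply: smooth_sum => // k _; apply: smoothM => //; exact: smooth_entry.
Qed.

Lemma smooth_tr V m n (O : set V) (F : V -> 'M[R]_(m, n)) : open O ->
  smooth O F -> smooth O (fun x => (F x)^T).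
Proof.
move=> oO sF; apply: smooth_mx => // i j.
apply: (@smooth_eq _ _ _ (fun x => F x j i : R^o)) => //; last exact: smooth_entry.
by move=> x _; rewrite mxE.
Qed.

Lemma smoothZ V m n (O : set V) (f : V -> R^o) (F : V -> 'M[R]_(m, n)) : open O ->
  smooth O f -> smooth O F -> smooth O (fun x => f x *: F x).
Proof.
move=> oO sf sF; apply: smooth_mx => // i j.
apply: (@smooth_eq _ _ _ (fun x => f x * F x i j : R^o)) => //.
  by move=> x _; rewrite mxE.
by apply: smoothM => //; exact: smooth_entry.
Qed.

Lemma smooth_det V n (O : set V) (F : V -> 'M[R]_n) : open O ->
  smooth O F -> smooth O (fun x => \det (F x) : R^o).
Proof.
move=> oO sF; rewrite /determinant; apply: smooth_sum => // s _.
apply: smoothM => //; first exact: smooth_cst.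
by apply: smooth_prod => // i; exact: smooth_entry.
Qed.

Lemma smooth_adj V n (O : set V) (F : V -> 'M[R]_n) : open O ->
  smooth O F -> smooth O (fun x => \adj (F x)).
Proof.
move=> oO sF; apply: smooth_mx => // i j.
apply: (@smooth_eq _ _ _ (fun x => cofactor (F x) j i : R^o)) => //.
  by move=> x _; rewrite mxE.
rewrite /cofactor; apply: smoothM => //; first exact: smooth_cst.
apply: smooth_det => //; apply: smooth_mx => // i' j'.
apply: (@smooth_eq _ _ _ (fun x => F x (lift j i') (lift i j') : R^o)) => //.
  by move=> x _; rewrite !mxE.
exact: smooth_entry.
Qed.

Lemma smooth_comp_mx V n p q (O : set V) (U : set 'rV[R]_n) (g : V -> 'rV[R]_n)
    (F : 'rV[R]_n -> 'M[R]_(p, q)) : open O -> open U ->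
  (forall x, O x -> U (g x)) ->
  smooth O g -> smooth U F -> smooth O (fun x => F (g x)).
Proof.
move=> oO oU gOU sg sF; apply: smooth_mx => // i j k.
apply: (@Ck_comp _ _ _ _ U g (fun y => F y i j)) => //.
exact: Ck_entry.
Qed.

Lemma smooth_comp_fun V n (O : set V) (U : set 'rV[R]_n) (g : V -> 'rV[R]_n)
    (f : 'rV[R]_n -> R^o) : open O ->
  (forall x, O x -> U (g x)) ->
  smooth O g -> smooth U f -> smooth O (fun x => f (g x)).
Proof. by move=> oO gOU sg sf k; exact: (@Ck_comp _ _ _ _ U g f). Qed.

Lemma smooth_jacobian n p (O : set 'rV[R]_n) (f : 'rV[R]_n -> 'rV[R]_p) :
  open O -> smooth O f -> smooth O (fun x => jacobian f x).
Proof.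
move=> oO sf; apply: smooth_mx => // i j.
apply: (@smooth_eq _ _ _ (fun x => ('D_(delta_mx 0 i) f x) 0 j : R^o)) => //.
  move=> x Ox; rewrite deriveEjacobian; last exact: smooth_differentiable sf Ox.
  by rewrite -rowE mxE.
by apply: smooth_entry => //; exact: smooth_derive.
Qed.

End MatrixCalculus.

(** * Mean values along lines and symmetry of second derivatives *)

Section Schwarz.
Context {R : realType}.
Implicit Types (V W : normedModType R).

Lemma is_derive_line V (f : V -> R^o) x v (t : R) :
  derivable f (x + t *: v) v ->
  is_derive t (1 : R) (fun s => f (x + s *: v) : R) ('D_v f (x + t *: v)).
Proof.
have E : (fun h : R => h^-1 *: (((fun s => f (x + s *: v)) \o shift t) (h *: (1 : R)) -
    f (x + t *: v)) : R) =
    (fun h => h^-1 *: ((f \o shift (x + t *: v)) (h *: v) - f (x + t *: v))).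
  apply/funext => h /=; congr (_ *: (f _ - _)).
  by rewrite [h *: 1]mulr1 scalerDl addrCA.
by move=> df; split; rewrite /derivable /derive E.
Qed.

Lemma MVT_line V (f : V -> R^o) x v (s : R) : 0 < s ->
  (forall t, 0 <= t <= s -> differentiable f (x + t *: v)) ->
  exists2 c, 0 < c < s & f (x + s *: v) - f x = s * 'D_v f (x + c *: v).
Proof.
move=> s0 df.
have H t : 0 <= t <= s -> is_derive t (1 : R) (fun s => f (x + s *: v) : R) ('D_v f (x
    + t *: v)).
  by move=> ts; apply: is_derive_line; apply: diff_derivable; exact: df.
have [||c /[!in_itv]/= cs] := @MVT R (fun s => f (x + s *: v)) (fun s => 'D_v f (x + s
    *: v)) 0 s s0.
- by move=> t /[!in_itv]/= /andP[t0 ts]; apply: H; rewrite !ltW.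
- apply: continuous_in_subspaceT => t /[!inE]/= /[!in_itv]/= ts.
  apply: differentiable_continuous; apply/derivable1_diffP.
  by have [] := H _ ts.
by rewrite scale0r addr0 subr0 mulrC => E; exists c.
Qed.

(** The mean value theorem is used twice: along [u] for [y |-> f (y + s v) - f y], then along [v]
    for ['D_u f]. *)
Lemma mixed_MVT V (f : V -> R^o) x u v (s : R) : 0 < s ->
  (forall a b : R, 0 <= a <= s -> 0 <= b <= s ->
     differentiable f (x + a *: u + b *: v) /\
     differentiable ('D_u f) (x + a *: u + b *: v)) ->
  exists a b : R, [/\ 0 <= a <= s, 0 <= b <= s &
    f (x + s *: u + s *: v) - f (x + s *: u) - (f (x + s *: v) - f x) =
    s * s * 'D_v ('D_u f) (x + a *: u + b *: v)].
Proof.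
move=> s0 H; have ss : 0 <= s <= s by rewrite lexx ltW.
have s00 : 0 <= (0 : R) <= s by rewrite lexx ltW.
pose g y := f (y + s *: v) - f y.
have dsh y : differentiable f (y + s *: v) -> differentiable (fun z => f (z + s *: v)) y.
  by move=> dfy; apply: (@differentiable_comp _ _ _ _ (fun z : V => z + s *: v) f).
have Dsh y : 'D_u (fun z => f (z + s *: v)) y = 'D_u f (y + s *: v).
  rewrite /derive.
  have -> : (fun h : R => h^-1 *: (((fun z => f (z + s *: v)) \o shift y) (h *: u) -
      f (y + s *: v)) : R^o) =
    (fun h => h^-1 *: ((f \o shift (y + s *: v)) (h *: u) - f (y + s *: v))) => //.
  by apply/funext => h /=; rewrite addrA.
have dg t : 0 <= t <= s -> differentiable g (x + t *: u).
  move=> ts; have [d1 _] := H t s ts ss; have [d2 _] := H t 0 ts s00.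
  by apply: (@differentiableB _ _ _ (fun z => f (z + s *: v)) f); [exact: dsh|move: d2;
      rewrite scale0r addr0].
have [|a /andP[a0 as_] E] := @MVT_line _ g x u s s0; first exact: dg.
have ats : 0 <= a <= s by rewrite !ltW.
have Da : 'D_u g (x + a *: u) = 'D_u f (x + a *: u + s *: v) - 'D_u f (x + a *: u).
  have [d1 _] := H a s ats ss; have [d2 _] := H a 0 ats s00.
  rewrite -Dsh -deriveB//; first exact/diff_derivable/dsh.
  by apply: diff_derivable; move: d2; rewrite scale0r addr0.
have [|b /andP[b0 bs] E'] := @MVT_line _ ('D_u f) (x + a *: u) v s s0.
  by move=> t ts; exact: (H a t ats ts).2.
exists a, b; split=> //; first by rewrite !ltW.
by rewrite -mulrA -E' -Da -E /g.
Qed.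

Lemma near_box V (P : set V) x u v : (\near x, P x) ->
  exists2 r : R, 0 < r & forall a b : R, `|a| <= r -> `|b| <= r -> P (x + a *: u + b *: v).
Proof.
move=> /nbhs_ballP[e /= e0 eP].
pose C := `|u| + `|v| + 1.
have C0 : 0 < C by rewrite ltr_wpDl// addr_ge0.
have r0 : 0 < e / C by rewrite divr_gt0.
exists (e / C) => // a b ha hb; apply: eP.
rewrite -ball_normE /= -addrA opprD addNKr opprD.
rewrite (le_lt_trans (ler_normB _ _))// normrN !normrZ.
have : `|a| * `|u| <= e / C * `|u| by rewrite ler_wpM2r.
have : `|b| * `|v| <= e / C * `|v| by rewrite ler_wpM2r.
have E : e = e / C * C by rewrite divfK// gt_eqF.
rewrite [X in _ < X]E {3}/C !mulrDr mulr1; lra.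
Qed.

(** The second difference of [f] is symmetric in [u] and [v]. By [mixed_MVT] the two mixed
    derivatives therefore agree at two points arbitrarily close to [x], and continuity gives
    equality at [x]. *)
Lemma derive_sym V (O : set V) (f : V -> R^o) x u v : open O ->
  smooth O f -> O x -> 'D_u ('D_v f) x = 'D_v ('D_u f) x.
Proof.
move=> oO sf Ox; apply/eqP; rewrite -subr_eq0 -normr_le0; apply/ler_addgt0Pl => e e0.
rewrite addr0.
have cont w w' : 'D_w ('D_w' f) y @[y --> x] --> 'D_w ('D_w' f) x.
  by apply: smooth_continuous Ox; do 2!apply: smooth_derive.
have near1 w w' : \forall y \near x, O y /\
    `|'D_w ('D_w' f) x - 'D_w ('D_w' f) y| < e / 2.
  have /cvgrPdist_lt/(_ (e / 2)) H := cont w w'.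
  near=> y; split; first by near: y; exact: (near_open oO Ox).
  by near: y; apply: H; rewrite divr_gt0.
have [r1 r10 H1] := near_box u v (near1 v u).
have [r2 r20 H2] := near_box v u (near1 u v).
pose s := Num.min r1 r2.
have s0 : 0 < s by rewrite lt_min r10.
have bd t : 0 <= t <= s -> `|t| <= r1 /\ `|t| <= r2.
  move=> /andP[t0 ts]; rewrite ger0_norm//.
  by split; apply: le_trans ts _; rewrite ge_min lexx ?orbT.
have sdf w w' y : O y -> differentiable f y /\ differentiable ('D_w f) y.
  move=> Oy; split; first exact: smooth_differentiable sf Oy.
  by apply: smooth_differentiable Oy; exact: smooth_derive.
have [|a [b [ha hb E1]]] := @mixed_MVT _ f x u v s s0.
  by move=> a b /bd[ha _] /bd[hb _]; apply: sdf => //; exact: (H1 _ _ ha hb).1.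
have [|a' [b' [ha' hb' E2]]] := @mixed_MVT _ f x v u s s0.
  by move=> a' b' /bd[_ ha'] /bd[_ hb']; apply: sdf => //; exact: (H2 _ _ ha' hb').1.
have [_ K1] := H1 _ _ (bd _ ha).1 (bd _ hb).1.
have [_ K2] := H2 _ _ (bd _ ha').2 (bd _ hb').2.
have cancel (k p q : R) : k != 0 -> k * p = k * q -> p = q by move=> k0 /(mulfI k0).
have swap (p q k l : R) : p - q - (k - l) = p - k - (q - l) by ring.
have close (p q k d : R) : `|p - k| < d / 2 -> `|q - k| < d / 2 -> `|p - q| <= d.
  move=> pk qk; rewrite (_ : p - q = (p - k) - (q - k)); last by ring.
  by rewrite (le_trans (ler_normB _ _))// (splitr d) lerD// ltW.
have E : 'D_v ('D_u f) (x + a *: u + b *: v) = 'D_u ('D_v f) (x + a' *: v + b' *: u).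
  apply: (@cancel (s * s)); first by rewrite mulf_neq0// gt_eqF.
  apply: etrans (esym E1) _; apply: etrans _ E2.
  rewrite [x + s *: v + s *: u]addrAC; exact: swap.
by rewrite E in K1; exact: (close _ _ _ _ K2 K1).
Unshelve. all: by end_near. Qed.

End Schwarz.

Section PointwiseDerivatives.
Context {R : realType} {V : normedModType R}.
Implicit Types (f g : V -> R^o) (x v : V).

Lemma derive_add f g x v : differentiable f x -> differentiable g x ->
  'D_v (fun y => f y + g y : R^o) x = 'D_v f x + 'D_v g x.
Proof. by move=> df dg; apply: deriveD; exact: diff_derivable. Qed.

Lemma derive_sub f g x v : differentiable f x -> differentiable g x ->
  'D_v (fun y => f y - g y : R^o) x = 'D_v f x - 'D_v g x.
Proof. by move=> df dg; apply: deriveB; exact: diff_derivable. Qed.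

Lemma derive_mul f g x v : differentiable f x -> differentiable g x ->
  'D_v (fun y => f y * g y : R^o) x = f x * 'D_v g x + g x * 'D_v f x.
Proof. by move=> df dg; apply: deriveM; exact: diff_derivable. Qed.

Lemma derive_cmul (c : R) f x v : differentiable f x ->
  'D_v (fun y => c * f y : R^o) x = c * 'D_v f x.
Proof. by move=> df; apply: (@deriveZ _ _ _ f c); exact: diff_derivable. Qed.

Lemma derive_inv f x v : differentiable f x -> f x != 0 ->
  'D_v (fun y => (f y)^-1 : R^o) x = - ('D_v f x / (f x * f x)).
Proof.
move=> df f0; rewrite deriveV//; last exact: diff_derivable.
by rewrite /GRing.scale/= expr2 mulNr mulrC.
Qed.

Lemma derive_div f g x v : differentiable f x -> differentiable g x -> g x != 0 ->
  'D_v (fun y => f y / g y : R^o) x =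
  ('D_v f x * g x - f x * 'D_v g x) / (g x * g x).
Proof.
move=> df dg g0; rewrite (@derive_mul f (fun y => (g y)^-1))//; last exact: differentiableV.
rewrite derive_inv//.
have H (a b c d : R) : b != 0 -> a * - (d / (b * b)) + b^-1 * c = (c * b - a * d) / (b * b).
  by move=> b0; field.
exact: H.
Qed.

End PointwiseDerivatives.

(** * Division by the equation of a hypersurface *)

Section Hypersurface.
Context {R : realType} {n : nat}.
Notation V := 'rV[R]_n.
Variables (O : set V) (tau : V -> R^o) (e : V).
Hypothesis oO : open O.
Hypothesis stau : smooth O tau.
Hypothesis De : forall x, O x -> 'D_e tau x != 0.
Implicit Types (f g w k : V -> R^o) (x y u v : V).

Lemma line_inj x v (s : R) : 0 < s -> (forall t : R, 0 <= t <= s -> O (x + t *: v)) ->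
  (forall t : R, 0 <= t <= s -> 'D_v tau (x + t *: v) != 0) ->
  tau (x + s *: v) != tau x.
Proof.
move=> s0 Os Ds; have [|c cs E] := @MVT_line _ _ tau x v s s0.
  by move=> t /Os Ot; exact: smooth_differentiable stau Ot.
have Dc : 'D_v tau (x + c *: v) != 0.
  by apply: Ds; case/andP: cs => c0 c1; rewrite !ltW.
apply/eqP => E'; move: E; rewrite E' subrr => /esym/eqP.
by apply/negP; exact: (mulf_neq0 (lt0r_neq0 s0) Dc).
Qed.

(** The point is uniformity: one length [d] serves all [y] near [x]. *)
Lemma near_tube x v (P : set V) : (\near x, P x) ->
  exists2 d : R, 0 < d & \forall y \near x, forall t : R, `|t| <= d -> P (y + t *: v).
Proof.
move=> /nbhs_ballP[r /= r0 rP].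
have C0 : 0 < `|v| + 1 by rewrite ltr_wpDl.
exists (r / 2 / (`|v| + 1)); first by rewrite !divr_gt0.
apply/nbhs_ballP; exists (r / 2); first by rewrite /= divr_gt0.
move=> y; rewrite -ball_normE /= => xy t ht; apply: rP.
rewrite -ball_normE /= opprD addrA (le_lt_trans (ler_normB _ _))//.
rewrite normrZ (splitr r) ltr_leD//.
apply: (@le_trans _ _ (r / 2 / (`|v| + 1) * (`|v| + 1))); last by rewrite divfK// gt_eqF.
by apply: ler_pM => //; rewrite lerDl.
Qed.

(** Moving along [e] leaves the hypersurface at once, because [tau] is injective on such a segment.
    Hence points with [tau] nonzero are dense. *)
Lemma dense_off f x : O x -> tau x = 0 -> f y @[y --> x] --> f x ->
  (\forall y \near x, tau y != 0 -> f y = 0) -> f x = 0.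
Proof.
move=> Ox tx cf f0; apply/eqP; apply: contraT => fx0.
have /cvgrPdist_lt/(_ `|f x|) := cf; rewrite normr_gt0 => /(_ fx0) cf'.
have [r r0 H] : exists2 r : R, 0 < r & forall a b : R, `|a| <= r -> `|b| <= r ->
    [set y | [/\ O y, `|f x - f y| < `|f x| & tau y != 0 -> f y = 0]] (x + a *: e + b *: 0).
  apply: near_box; near=> y; split; first by near: y; exact: (near_open oO Ox).
    by near: y.
  by near: y.
have {}H (a : R) : 0 <= a <= r -> [/\ O (x + a *: e), `|f x - f (x + a *: e)| < `|f x| &
    tau (x + a *: e) != 0 -> f (x + a *: e) = 0].
  move=> /andP[a0 ar]; have := H a 0; rewrite scaler0 addr0; apply; last by rewrite normr0 ltW.
  by rewrite ger0_norm.
have rr : 0 <= r <= r by rewrite lexx ltW.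
have [_ H1 H2] := H r rr.
have : tau (x + r *: e) != tau x.
  apply: line_inj => // t /H[Ot _ _] //; exact: De.
by rewrite tx => /H2 fr; move: H1; rewrite fr subr0 ltxx.
Unshelve. all: by end_near. Qed.

Lemma neg_prod_real (d a b c : R) : 0 < d -> c != 0 -> 0 < a * c -> 0 < b * c ->
  (d * a) * (d * - b) < 0.
Proof.
move=> d0 c0 ac bc; have c2 : 0 < c * c by rewrite -expr2 exprn_even_gt0.
have : 0 < (a * b) * (c * c) by rewrite mulrACA mulr_gt0.
rewrite pmulr_lgt0// => ab; rewrite mulrACA mulrN mulrN oppr_lt0.
by rewrite mulr_gt0 // mulr_gt0.
Qed.

Lemma between_real (a b : R) : a * b < 0 -> Num.min b a <= 0 <= Num.max b a.
Proof.
move=> ab; rewrite ge_min le_max.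
case: (ltgtP a 0) => h; case: (ltgtP b 0) => h' //; nra.
Qed.

(** This replaces the projection onto the hypersurface along [e] that the implicit function theorem
    would give. The signs of [tau] at [x + d e] and [x - d e] are opposite, hence also at [y + d e]
    and [y - d e] for [y] near [x], and the intermediate value theorem finds the crossing. *)
Lemma tau_crosses x (P : set V) : O x -> tau x = 0 -> (\near x, P x) ->
  \forall y \near x, exists2 s : R, tau (y + s *: e) = 0 &
    forall t : R, 0 <= t <= 1 -> P (y + (t * s) *: e).
Proof.
move=> Ox tx nP.
have nD : \forall y \near x, 0 < 'D_e tau y * 'D_e tau x.
  have c : ('D_e tau y * 'D_e tau x : R^o) @[y --> x] --> 'D_e tau x * 'D_e tau x.
    exact: cvgM (smooth_continuous (smooth_derive e stau) Ox) (cvg_cst _).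
  have p : 0 < 'D_e tau x * 'D_e tau x :> R.
    by rewrite -expr2 exprn_even_gt0//= De.
  have /cvgrPdist_lt/(_ _ p) := c; apply: filterS => y.
  by rewrite ltr_distlC => /andP[]; rewrite subrr.
have [d d0 nd] : exists2 d : R, 0 < d & \forall y \near x, forall t : R, `|t| <= d ->
    [set y | [/\ O y, P y & 0 < 'D_e tau y * 'D_e tau x]] (y + t *: e).
  apply: near_tube; near=> y; split.
  - by near: y; exact: (near_open oO Ox).
  - by near: y.
  - by near: y.
have nOP (t : R) : 0 <= t <= d -> (O (x + t *: e) /\ 0 < 'D_e tau (x + t *: e) * 'D_e tau x) /\
   (O (x - t *: e) /\ 0 < 'D_e tau (x - t *: e) * 'D_e tau x).
  move=> /andP[t0 td]; have H := nbhs_singleton nd.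
  have [] := H t; first by rewrite ger0_norm.
  have [] := H (- t); first by rewrite normrN ger0_norm.
  by rewrite scaleNr.
have dd : 0 <= d <= d by rewrite lexx ltW.
(* Each factor is a mean value of ['D_e tau] times [d] or [- d], and ['D_e tau] keeps the sign it
   has at [x]. *)
have prod0 : tau (x + d *: e) * tau (x - d *: e) < 0.
  have [|c /andP[c0 cd] E] := @MVT_line _ _ tau x e d d0.
    by move=> t /nOP[[Ot _] _]; exact: smooth_differentiable stau Ot.
  have [|c' /andP[c'0 c'd] E'] := @MVT_line _ _ tau x (- e) d d0.
    by move=> t /nOP[_ [Ot _]]; rewrite scalerN; exact: smooth_differentiable stau Ot.
  move: E E'; rewrite tx !subr0 !scalerN => E E'.
  have [|[Oc S1] _] := nOP c; first by rewrite !ltW.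
  have [|_ [Oc' S2]] := nOP c'; first by rewrite !ltW.
  have DN : 'D_(- e) tau (x - c' *: e) = - 'D_e tau (x - c' *: e).
    by rewrite !deriveE ?linearN//; exact: smooth_differentiable stau Oc'.
  rewrite DN in E'; rewrite E E'.
  exact: (neg_prod_real d0 (De Ox)).
have shift_cvg (z : V) : (y + z) @[y --> x] --> x + z.
  exact: (@cvgD _ _ _ (nbhs x) _ id (fun=> z) x z (@cvg_id _ _) (cvg_cst z)).
have nprod : \forall y \near x, tau (y + d *: e) * tau (y - d *: e) < 0.
  have c : (tau (y + d *: e) * tau (y - d *: e) : R^o) @[y --> x] -->
      tau (x + d *: e) * tau (x - d *: e).
    have [[h1 _] [h2 _]] := nOP d dd.
    have c (z : V) : O (x + z) -> tau (y + z) @[y --> x] --> tau (x + z).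
      by move=> Oz; apply: cvg_comp (shift_cvg z) _; exact: smooth_continuous stau Oz.
    exact: cvgM (c _ h1) (c _ h2).
  have p : 0 < - (tau (x + d *: e) * tau (x - d *: e)) :> R by rewrite oppr_gt0.
  have /cvgrPdist_lt/(_ _ p) := c; apply: filterS => y.
  by rewrite ltr_distlC => /andP[_]; rewrite subrr.
near=> y.
have H : forall t : R, `|t| <= d ->
    [/\ O (y + t *: e), P (y + t *: e) & 0 < 'D_e tau (y + t *: e) * 'D_e tau x].
  by near: y; exact: nd.
have pr : tau (y + d *: e) * tau (y - d *: e) < 0 by near: y.
have [||/= |s /[!in_itv]/= sd ts] := @IVT R (fun t => tau (y + t *: e)) (- d) d 0.
- by rewrite ge0_cp// ltW.
- apply: continuous_in_subspaceT => t /[!inE]/= /[!in_itv]/= td.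
  apply: differentiable_continuous; apply/derivable1_diffP.
  have [|Ot _ _] := H t; first by rewrite ler_norml.
  by have [] := is_derive_line (smooth_derivable (v := e) stau Ot).
- by rewrite scaleNr; exact: between_real.
exists s => // t /andP[t0 t1].
have [|//] := H (t * s).
rewrite normrM (ger0_norm t0); apply: (@le_trans _ _ `|s|); first by rewrite ler_piMl.
by rewrite ler_norml.
Unshelve. all: by end_near. Qed.

Lemma dense_off_eq f h : smooth O f -> smooth O h ->
  (forall x, O x -> tau x != 0 -> f x = h x) -> forall x, O x -> f x = h x.
Proof.
move=> sf sh fh x Ox; have [tx|tx] := eqVneq (tau x) 0; last exact: fh.
apply/eqP; rewrite -subr_eq0; apply/eqP.
have sB : smooth O (fun y => f y - h y : R^o) by exact: smoothB.
apply: (dense_off Ox tx (smooth_continuous sB Ox)).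
by apply: (near_open oO Ox) => y Oy ty; rewrite fh// subrr.
Qed.

End Hypersurface.

(** * Continuity of quotients by powers of [tau] *)

Section Division.
Context {R : realType} {n : nat}.
Notation V := 'rV[R]_n.
Variables (O : set V) (tau : V -> R^o) (e : V).
Hypothesis oO : open O.
Hypothesis stau : smooth O tau.
Hypothesis De : forall x, O x -> 'D_e tau x != 0.
Implicit Types (f g w k : V -> R^o) (x y u v : V).

(* [w] vanishes to order [m] on the hypersurface [tau = 0]. *)
Fixpoint flat (m : nat) (w : V -> R^o) : Prop :=
  match m with
  | 0 => smooth O w
  | m'.+1 => [/\ smooth O w, forall x, O x -> tau x = 0 -> w x = 0 &
                 forall v, flat m' (fun x => 'D_v w x)]
  end.

Lemma flat_smooth m w : flat m w -> smooth O w.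
Proof. by case: m => [//|m] []. Qed.

Lemma flat_eq m w w' : (forall x, O x -> w x = w' x) -> flat m w -> flat m w'.
Proof.
elim: m w w' => [|m IH] w w' E /=; first exact: smooth_eq.
move=> [sw w0 Dw]; split=> [|x Ox tx|v]; first exact: smooth_eq E sw.
  by rewrite -E// w0.
by apply: IH (Dw v) => x Ox; apply: near_eq_derive; exact: near_open oO Ox E.
Qed.

Lemma flatW m w : flat m.+1 w -> flat m w.
Proof.
elim: m w => [|m IH] w [sw w0 Dw] //=.
by split=> // v; apply: IH; exact: Dw.
Qed.

Lemma flatD m w w' : flat m w -> flat m w' -> flat m (fun x => w x + w' x : R^o).
Proof.
elim: m w w' => [|m IH] w w' /=; first exact: smoothD.
move=> [sw w0 Dw] [sw' w'0 Dw']; split=> [|x Ox tx|v]; first exact: smoothD.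
  by rewrite w0// w'0// addr0.
apply: flat_eq (IH _ _ (Dw v) (Dw' v)) => x Ox.
by rewrite derive_add//; [exact: smooth_differentiable sw Ox|exact:
    smooth_differentiable sw' Ox].
Qed.

Lemma flatM m k w : smooth O k -> flat m w -> flat m (fun x => k x * w x : R^o).
Proof.
elim: m k w => [|m IH] k w sk; first by move=> /= sw; exact: smoothM.
move=> fw; have fw' := flatW fw; case: fw => sw w0 Dw.
split=> [|x Ox tx|v]; first exact: smoothM.
  by rewrite w0// mulr0.
have := flatD (IH _ _ sk (Dw v)) (IH _ _ (smooth_derive v sk) fw').
apply: flat_eq => x Ox.
rewrite derive_mul; [|exact: smooth_differentiable sk Ox|exact: smooth_differentiable sw Ox].
by rewrite ['D_v k x * _]mulrC.
Qed.

Lemma flat_tau m w : flat m w -> flat m.+1 (fun x => tau x * w x : R^o).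
Proof.
elim: m w => [|m IH] w fw; have sw := flat_smooth fw.
all: split=> [|x Ox tx|v]; [exact: smoothM|by rewrite tx mul0r|].
  by apply: smooth_derive; exact: smoothM.
have fw' := flatW fw; case: (fw) => _ w0 Dw.
have := flatD (IH _ (Dw v)) (flatM (smooth_derive v stau) fw).
apply: flat_eq => x Ox.
rewrite derive_mul; [|exact: smooth_differentiable stau Ox|exact: smooth_differentiable sw Ox].
by rewrite ['D_v tau x * _]mulrC.
Qed.

(** The derivative of [w] with respect to [tau] along the lines in direction [e]. *)
Definition slope w : V -> R^o := fun y => 'D_e w y / 'D_e tau y.

Lemma flat_slope m w : flat m.+1 w -> flat m (slope w).
Proof.
case=> sw w0 Dw; have sV : smooth O (fun y => ('D_e tau y)^-1 : R^o).
  by apply: smoothV => //; exact: smooth_derive.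
by apply: flat_eq (flatM sV (Dw e)) => x Ox; rewrite mulrC.
Qed.

(* [w / tau ^+ m]; the values on the hypersurface are those given by
   l'Hopital's rule along [e]. *)
Fixpoint quot (m : nat) (w : V -> R^o) (x : V) : R^o :=
  if tau x == 0 then
    match m with
    | 0 => w x
    | m'.+1 => quot m' (slope w) x / m'.+1%:R
    end
  else w x / tau x ^+ m.

Lemma quot_off m w x : tau x != 0 -> quot m w x = w x / tau x ^+ m.
Proof. by case: m => [|m] /= /negbTE ->. Qed.

Lemma quot0 w x : quot 0 w x = w x.
Proof. by rewrite /=; case: ifP => // _; rewrite expr0 divr1. Qed.

Let O1 := [set x | O x /\ tau x != 0].

Lemma open_off : open O1.
Proof.
rewrite openE => x [Ox tx]; rewrite /interior.
have /cvgrPdist_lt/(_ `|tau x|) := smooth_continuous stau Ox.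
rewrite normr_gt0 => /(_ tx) H; near=> y; split; first by near: y; exact: (near_open oO Ox).
have : `|tau x - tau y| < `|tau x| by near: y.
by apply: contraTneq => ->; rewrite subr0 ltxx.
Unshelve. all: by end_near. Qed.

Lemma smoothX (U : set V) f m : open U -> smooth U f -> smooth U (fun x => f x ^+ m : R^o).
Proof.
move=> oU sf; elim: m => [|m IH].
  by apply: (@smooth_eq _ _ _ _ (fun=> 1 : R^o)) => //; exact: smooth_cst.
apply: (@smooth_eq _ _ _ _ (fun x => f x * f x ^+ m : R^o)) => //; last exact: smoothM.
by move=> x _; rewrite exprS.
Qed.

Lemma derive_exp f m x v : differentiable f x ->
  differentiable (fun y => f y ^+ m : R^o) x /\
  'D_v (fun y => f y ^+ m : R^o) x = m%:R * f x ^+ m.-1 * 'D_v f x.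
Proof.
move=> df; elim: m => [|m [dX DX]].
  by split; [exact: differentiable_cst|rewrite mul0r mul0r; exact: derive_cst].
have -> : (fun y => f y ^+ m.+1 : R^o) = (fun y => f y * f y ^+ m).
  by apply/funext => y; rewrite exprS.
split; first exact: differentiableM df dX.
rewrite (derive_mul v df dX) DX.
have H (a b : R) : a * (m%:R * a ^+ m.-1 * b) + a ^+ m * b = m.+1%:R * a ^+ m * b.
  case: m {dX DX} => [|m] /=; first by rewrite expr0; ring.
  by rewrite exprS -!natr1; ring.
exact: H.
Qed.

Lemma smooth_quot_off m w : smooth O w ->
  smooth O1 (fun x => w x / tau x ^+ m : R^o).
Proof.
move=> sw; have sub : O1 `<=` O by move=> x [].
apply: smooth_div; [exact: open_off| |exact: smooth_sub sw|].
  by move=> x [_ tx]; rewrite expf_neq0.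
by apply: smoothX; [exact: open_off|exact: smooth_sub stau].
Qed.

(** Cauchy's mean value theorem for [w] and [tau ^ (m+1)], both zero at the crossing point:
    [w / tau ^ (m+1)] at [y] equals the ratio of the derivatives, [slope w / ((m+1) tau ^ m)], at a
    point in between. *)
Lemma quot_step m w y (s : R) : flat m.+1 w -> tau (y + s *: e) = 0 ->
  (forall t : R, 0 <= t <= 1 -> O (y + (t * s) *: e)) ->
  exists2 t : R, 0 <= t <= 1 &
    quot m.+1 w y = quot m (slope w) (y + (t * s) *: e) / m.+1%:R.
Proof.
move=> fw ts Os; have [ty|ty] := eqVneq (tau y) 0.
  by exists 0; rewrite ?lexx ?ler01// mul0r scale0r addr0 /= ty eqxx.
have s0 : s != 0 by apply: contra_neq ty => s0; rewrite -ts s0 scale0r addr0.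
case: (fw) => sw w0 _.
(* The segment is run from the crossing point [q] back to [y], so that [tau] starts from zero. *)
pose q := y + s *: e; pose u := (- s) *: e.
have qE (t : R) : q + t *: u = y + ((1 - t) * s) *: e.
  by rewrite /q /u -addrA scalerA -scalerDl; congr (_ + _ *: _); ring.
have Oq (t : R) : 0 <= t <= 1 -> O (q + t *: u).
  move=> /andP[t0 t1]; rewrite qE; apply: Os.
  by rewrite subr_ge0 t1 lerBlDr lerDl t0.
have Du f x : smooth O f -> O x -> 'D_u f x = - s * 'D_e f x.
  move=> sf Ox; have df := smooth_differentiable sf Ox.
  by rewrite !deriveE// linearZ.
pose a : R := tau y ^+ m.+1; pose b : R := w y.
have a0 : a != 0 by rewrite expf_neq0.
(* The auxiliary function of Cauchy's theorem; it vanishes at both ends. *)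
pose H z : R^o := w z * a - b * tau z ^+ m.+1.
have Hq : H q = 0 by rewrite /H w0 ?ts ?expr0n ?mul0r ?mulr0 ?subr0//; have := Oq 0;
    rewrite scale0r addr0; apply; rewrite lexx ler01.
have Hy : H (q + 1 *: u) = 0.
  by rewrite qE subrr mul0r scale0r addr0 /H mulrC subrr.
have dw z : O z -> differentiable (fun z => w z * a : R^o) z.
  move=> Oz; apply: differentiableM; last exact: differentiable_cst.
  exact: smooth_differentiable sw Oz.
have dt z : O z -> differentiable (fun z => b * tau z ^+ m.+1 : R^o) z.
  move=> Oz; apply: differentiableM; first exact: differentiable_cst.
  exact: (derive_exp m.+1 u (smooth_differentiable stau Oz)).1.
have [|c /andP[c0 c1] E] := @MVT_line _ _ H q u 1 ltr01.
  by move=> t /Oq Ot; apply: differentiableB; [exact: dw|exact: dt].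
have c01 : 0 <= c <= 1 by rewrite !ltW.
have Oc := Oq c c01.
(* The intermediate point is off the hypersurface, so the quotient there is an actual division. *)
have tc : tau (q + c *: u) != 0.
  have <- : tau q = 0 by [].
  apply: (line_inj stau) => // t /andP[t0 tc].
    by apply: Oq; rewrite t0 (le_trans tc)// ltW.
  have Ot : O (q + t *: u) by apply: Oq; rewrite t0 (le_trans tc)// ltW.
  by rewrite Du// mulf_neq0 ?oppr_eq0//; exact: De.
exists (1 - c); first by rewrite subr_ge0 ltW// lerBlDr lerDl ltW.
rewrite -qE; set z := q + c *: u in E Oc tc *.
rewrite !quot_off// -/a -/b /slope.
have := E; rewrite Hq Hy subrr mul1r.
rewrite (derive_sub _ (dw _ Oc) (dt _ Oc)).
have dwz := smooth_differentiable sw Oc; have dtz := smooth_differentiable stau Oc.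
have [dX DX] := derive_exp m.+1 u dtz.
rewrite (derive_mul _ dwz (differentiable_cst _ _)) derive_cst derive_cmul// DX.
rewrite !Du//.
have Dez : 'D_e tau z != 0 by exact: De.
have key (A B s' Dw Dt tz k : R) : A != 0 -> Dt != 0 -> tz != 0 -> s' != 0 -> k != 0 ->
    0 = w z * 0 + A * (- s' * Dw) - B * (k * tz ^+ m * (- s' * Dt)) ->
    B / A = Dw / Dt / tz ^+ m / k.
  move=> A0 Dt0 tz0 s'0 k0 h.
  have {}h : s' * (A * Dw) = s' * (B * k * tz ^+ m * Dt) by lra.
  have {}h := mulfI s'0 h.
  have tm0 : tz ^+ m != 0 by rewrite expf_neq0.
  apply: (mulIf A0); rewrite divfK//.
  apply: (mulIf k0); apply: (mulIf tm0); apply: (mulIf Dt0).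
  rewrite -h; move: (tz ^+ m) tm0 => T T0; field.
  by rewrite Dt0 T0 k0.
by apply: key => //; rewrite pnatr_eq0.
Qed.

(** At a point of the hypersurface, [quot_step] expresses the value at [y] through the quotient of
    order one less, taken on a segment that [tau_crosses] keeps near [x]; that quotient is
    continuous by induction. *)
Lemma quot_continuous m w x : flat m w -> O x -> quot m w y @[y --> x] --> quot m w x.
Proof.
elim: m w => [|m IH] w fw Ox; have sw := flat_smooth fw.
  have -> : quot 0 w = w by apply/funext => y; exact: quot0.
  exact: smooth_continuous sw Ox.
have [tx|tx] := eqVneq (tau x) 0; last first.
  rewrite quot_off//.
  have c := smooth_continuous (smooth_quot_off m.+1 sw) (conj Ox tx).
  have E : O1 `<=` [set y | w y / tau y ^+ m.+1 = quot m.+1 w y].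
    by move=> y [_ ty]; rewrite /mkset quot_off.
  have N : \forall y \near x, w y / tau y ^+ m.+1 = quot m.+1 w y.
    exact: (@near_open _ O1 _ x open_off (conj Ox tx) E).
  exact: (cvg_trans (near_eq_cvg N) c).
have c : quot m (slope w) y / m.+1%:R @[y --> x] --> quot m.+1 w x.
  rewrite /= tx eqxx.
  exact: cvgM (IH _ (flat_slope fw) Ox) (cvg_cst _).
apply/(@cvgrPdist_lt _ _ _ (nbhs x)) => eps eps0.
have nP : \forall y \near x, O y /\
    `|quot m.+1 w x - quot m (slope w) y / m.+1%:R| < eps.
  move/cvgrPdist_lt/(_ eps eps0): c => c.
  by near=> y; split; [near: y; exact: (near_open oO Ox)|near: y].
have := tau_crosses oO stau De Ox tx nP; apply: filterS => y [s ts H].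
have [|t t01 ->] := quot_step fw ts; first by move=> t /H[].
by have [] := H t t01.
Unshelve. all: by end_near. Qed.

End Division.

(** * Orders of vanishing of derivatives *)

Section Hadamard.
Context {R : realType} {n : nat}.
Notation V := 'rV[R]_n.
Variables (O : set V) (tau : V -> R^o) (e : V).
Hypothesis oO : open O.
Hypothesis stau : smooth O tau.
Hypothesis De : forall x, O x -> 'D_e tau x != 0.
Implicit Types (f g w k : V -> R^o) (x y u v : V).

Lemma dnbhs_line x v : (h *: v + x) @[h --> (0 : R)^'] --> x.
Proof.
have c : (h *: v + x) @[h --> (0 : R)] --> x.
  have -> : x = 0 *: v + x :> V by rewrite scale0r add0r.
  rewrite [X in (fun h => h *: v + X)](_ : _ = x); last by rewrite scale0r add0r.
  exact: (@cvgD _ _ _ (nbhs (0 : R)) _ (fun h => h *: v) (fun=> x) _ _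
    (@scalel_continuous _ _ v 0) (cvg_cst x)).
exact: cvg_trans (cvg_app _ (@nbhs_dnbhs _ (0 : R))) c.
Qed.

Arguments dnbhs_line : clear implicits.

(** A Lagrange multiplier rule. Since [w = tau Q] with [Q] continuous and [tau x = 0], the
    difference quotient of [w] is that of [tau] times a factor tending to [Q x]; no
    differentiability of [Q] is involved. *)
Lemma vanish_derive w x u : smooth O w -> (forall y, O y -> tau y = 0 -> w y = 0) ->
  O x -> tau x = 0 -> 'D_u w x = 'D_u tau x * ('D_e w x / 'D_e tau x).
Proof.
move=> sw w0 Ox tx.
have fw : flat O tau 1 w by split=> // v; exact: smooth_derive.
have cQ := quot_continuous oO stau De fw Ox.
have Qx : quot tau e 1 w x = 'D_e w x / 'D_e tau x.
  by rewrite /= tx eqxx divr1.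
have wE y : O y -> w y = tau y * quot tau e 1 w y.
  move=> Oy; have [ty|ty] := eqVneq (tau y) 0; first by rewrite ty mul0r w0.
  by rewrite quot_off// expr1 mulrC divfK.
rewrite -Qx; apply: cvg_lim => //.
have dt : (fun h : R => h^-1 *: ((tau \o shift x) (h *: u) - tau x)) @ 0^' --> 'D_u tau x.
  exact: (smooth_derivable (v := u) stau Ox).
have cQ' : quot tau e 1 w (h *: u + x) @[h --> (0 : R)^'] --> quot tau e 1 w x.
  by apply: cvg_comp (dnbhs_line x u) _; exact: cQ.
have P := @cvgM _ _ _ (dnbhs_filter (0 : R)) _ _ _ _ dt cQ'.
have N : \forall h \near (0 : R)^',
    (h^-1 *: ((tau \o shift x) (h *: u) - tau x)) * quot tau e 1 w (h *: u + x) =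
    h^-1 *: ((w \o shift x) (h *: u) - w x) :> R^o.
  have nO : \forall h \near (0 : R)^', O (h *: u + x).
    exact: (dnbhs_line x u O (near_open oO Ox (fun _ h => h))).
  near=> h; have Oh : O (h *: u + x) by near: h.
  have E1 : (w \o shift x) (h *: u) = tau (h *: u + x) * quot tau e 1 w (h *: u + x) := wE _ Oh.
  rewrite E1 (w0 x Ox tx) tx !subr0.
  exact: (esym (mulrA (h^-1 : R) _ _)).
exact: cvg_trans (near_eq_cvg N) P.
Unshelve. all: by end_near. Qed.

(** The operator [(D_u tau) D_v - (D_v tau) D_u] differentiates along the hypersurface, so it does
    not lower the order of vanishing. *)
Lemma flat_tangential m w u v : flat O tau m w ->
  flat O tau m (fun x => 'D_u tau x * 'D_v w x - 'D_v tau x * 'D_u w x : R^o).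
Proof.
elim: m w u v => [|m IH] w u v fw; have sw := flat_smooth fw.
  by apply: smoothB => //; apply: smoothM => //; exact: smooth_derive.
have sT : smooth O (fun x => 'D_u tau x * 'D_v w x - 'D_v tau x * 'D_u w x : R^o).
  by apply: smoothB => //; apply: smoothM => //; exact: smooth_derive.
case: (fw) => _ w0 Dw; split=> // [x Ox tx|z].
  rewrite (vanish_derive u sw w0 Ox tx) (vanish_derive v sw w0 Ox tx).
  have H (a b c : R) : a * (b * c) - b * (a * c) = 0 by ring.
  exact: H.
have sD f a : smooth O f -> smooth O (fun x => 'D_a f x) by exact: smooth_derive.
have sDD a b := sD _ b (sD _ a stau).
have F1 := IH _ u v (Dw z).
have F2 := flatM oO (sDD u z) (Dw v).
have F3 := flatM oO (smoothN oO (sDD v z)) (Dw u).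
apply: (flat_eq oO _ (flatD oO F1 (flatD oO F2 F3))) => x Ox.
have df f : smooth O f -> differentiable f x by move=> sf; exact: smooth_differentiable sf Ox.
have dT a := df _ (sD _ a stau); have dW a := df _ (sD _ a sw).
have dM a b := differentiableM (dT a) (dW b).
rewrite (derive_sub z (dM u v) (dM v u)).
rewrite (derive_mul z (dT u) (dW v)) (derive_mul z (dT v) (dW u)).
rewrite (derive_sym v z oO sw Ox) (derive_sym u z oO sw Ox).
have H (a b c d p q r s : R) : a * b - c * d + (p * q + - r * s) = (a * b + q * p) - (c
    * d + s * r).
  by ring.
exact: H.
Qed.

(** This is the numerator of [D_v (w / tau ^ m)] over [tau ^ (m+1)], and it has to vanish to the
    matching order. Differentiating it along [y] yields the same expression for [D_y w] at one order
    less, a tangential derivative of [w], and a multiple of [w]. *)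
Lemma flat_quot_derive m w v : flat O tau m w ->
  flat O tau m.+1 (fun x => tau x * 'D_v w x - m%:R * (w x * 'D_v tau x) : R^o).
Proof.
elim: m w v => [|m IH] w v fw; have sw := flat_smooth fw.
  apply: (flat_eq oO _ (flat_tau oO stau (m := 0) (smooth_derive v sw))) => x Ox.
  by rewrite mul0r subr0.
have sD f a : smooth O f -> smooth O (fun x => 'D_a f x) by exact: smooth_derive.
have sM a f : smooth O f -> smooth O (fun x => a * f x : R^o).
  by move=> sf; apply: smoothM => //; exact: smooth_cst.
have sz : smooth O (fun x => tau x * 'D_v w x - m.+1%:R * (w x * 'D_v tau x) : R^o).
  apply: smoothB => //; first by apply: smoothM => //; exact: sD.
  by apply: sM; apply: smoothM => //; exact: sD.
case: (fw) => _ w0 Dw; split=> // [x Ox tx|y].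
  by rewrite tx w0// !mul0r mulr0 subr0.
have F1 := IH _ v (Dw y).
have F2 := flat_tangential y v fw.
have F3 := flatM oO (smoothN oO (sM m.+1%:R _ (sD _ y (sD _ v stau)))) fw.
apply: (flat_eq oO _ (flatD oO F1 (flatD oO F2 F3))) => x Ox.
have df f : smooth O f -> differentiable f x by move=> sf; exact: smooth_differentiable sf Ox.
have dt := df _ stau; have dw := df _ sw.
have dT a := df _ (sD _ a stau); have dW a := df _ (sD _ a sw).
have dwT := differentiableM dw (dT v).
have dcwT : differentiable (fun x => m.+1%:R * (w x * 'D_v tau x) : R^o) x.
  by apply: differentiableM => //; exact: differentiable_cst.
rewrite (derive_sub y (differentiableM dt (dW v)) dcwT).
rewrite (derive_mul y dt (dW v)) (derive_cmul _ y dwT) (derive_mul y dw (dT v)).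
rewrite (derive_sym v y oO sw Ox) -!natr1.
have H (t A B C D E F G : R) (k : R) :
  t * A - k * (B * C) + ((D * E - C * B) + - ((k + 1) * F) * G) =
  (t * A + E * D) - (k + 1) * (G * F + C * B) by ring.
exact: H.
Qed.

End Hadamard.

(** * Differentiability across the hypersurface and Hadamard division *)

Section AcrossHypersurface.
Context {R : realType} {n : nat}.
Notation V := 'rV[R]_n.
Variables (O : set V) (tau : V -> R^o) (e : V).
Hypothesis oO : open O.
Hypothesis stau : smooth O tau.
Hypothesis De : forall x, O x -> 'D_e tau x != 0.
Implicit Types (f g w k : V -> R^o) (x y u v : V).

Section Criterion.
Variables (f : V -> R^o) (psi : V -> V -> R).
Hypothesis cf : forall x, O x -> f y @[y --> x] --> f x.
Hypothesis cpsi : forall v x, O x -> (psi v y : R^o) @[y --> x] --> (psi v x : R^o).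
Hypothesis fpsi : forall x, O x -> tau x != 0 ->
  differentiable f x /\ forall v, 'D_v f x = psi v x.

Lemma segment_off a v (s t : R) : 0 <= s -> s < t -> t <= 1 ->
  (forall c : R, 0 <= c <= 1 -> O (a + c *: v)) ->
  (forall c : R, s < c < t -> tau (a + c *: v) != 0) ->
  exists2 c : R, 0 <= c <= 1 & f (a + t *: v) - f (a + s *: v) = (t - s) * psi v (a + c *: v).
Proof.
move=> s0 st t1 Oa ta.
have [||c /[!in_itv]/= cst E] := @MVT R (fun c => f (a + c *: v)) (fun c => psi v (a +
    c *: v)) s t st.
- move=> c /[!in_itv]/= cst; have Oc : O (a + c *: v).
    by apply: Oa; case/andP: cst => sc ct; rewrite !ltW ?(le_lt_trans s0)//; exact:
        lt_le_trans t1.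
  have [df Df] := fpsi Oc (ta _ cst); rewrite -Df.
  by apply: is_derive_line; exact: diff_derivable.
- apply: continuous_in_subspaceT => c /[!inE]/= /[!in_itv]/= /andP[sc ct].
  have Oc : O (a + c *: v) by apply: Oa; rewrite (le_trans s0)//= (le_trans ct).
  have cl : (a + h *: v) @[h --> c] --> a + c *: v.
    exact: (@cvgD _ _ _ (nbhs (c : R)) _ (fun=> a) (fun h => h *: v) _ _
      (cvg_cst a) (@scalel_continuous _ _ v c)).
  by apply: cvg_comp cl _; exact: cf Oc.
exists c; last by rewrite mulrC; exact: E.
by case/andP: cst => sc ct; rewrite (le_trans s0) ?(ltW sc)//= (le_trans (ltW ct)).
Qed.

Lemma convex_bound (a b L d t : R) : 0 <= t <= 1 -> `|a - L| <= d -> `|b - L| <= d ->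
  `|t * a + (1 - t) * b - L| <= d.
Proof.
move=> /andP[t0 t1]; rewrite !ler_norml => /andP[a1 a2] /andP[b1 b2].
by apply/andP; split; nra.
Qed.

(** As [tau] is injective on the segment, there is at most one crossing, at some [t]. The increment
    of [f] is then [t p1 + (1 - t) p2] with [p1], [p2] values of [psi v] on the segment, a convex
    combination within [d] of [L]. *)
Lemma segment_estimate a v (L d : R) :
  (forall c : R, 0 <= c <= 1 -> O (a + c *: v)) ->
  (forall c : R, 0 <= c <= 1 -> 'D_v tau (a + c *: v) != 0) ->
  (forall c : R, 0 <= c <= 1 -> `|psi v (a + c *: v) - L| <= d) ->
  `|f (a + v) - f a - L| <= d.
Proof.
move=> Oa Da Ha.
have inj (s t : R) : 0 <= s -> s < t -> t <= 1 -> tau (a + t *: v) != tau (a + s *: v).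
  move=> s0 st t1.
  have sh (c : R) : a + s *: v + c *: v = a + (s + c) *: v by rewrite -addrA scalerDl.
  have -> : a + t *: v = a + s *: v + (t - s) *: v by rewrite sh; congr (_ + _ *: _); ring.
  apply: (line_inj stau); first by rewrite subr_gt0.
    move=> c /andP[c0 cs]; rewrite sh; apply: Oa; rewrite addr_ge0//=; lra.
  move=> c /andP[c0 cs]; rewrite sh; apply: Da; rewrite addr_ge0//=; lra.
have E0 : a + 0 *: v = a by rewrite scale0r addr0.
have E1 : a + 1 *: v = a + v by rewrite scale1r.
have [[t /andP[t0 t1] tt]|no] := pselect (exists2 t : R, 0 < t < 1 & tau (a + t *: v) = 0).
- have [|c1 c1b e1] := @segment_off a v 0 t (lexx 0) t0 (ltW t1) Oa.
    by move=> c /andP[c0 ct]; rewrite -tt eq_sym; apply: inj => //; exact: ltW.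
  have [|c2 c2b e2] := @segment_off a v t 1 (ltW t0) t1 (lexx 1) Oa.
    by move=> c /andP[ct c1']; rewrite -tt; apply: inj => //; exact: ltW.
  rewrite E0 in e1; rewrite E1 in e2.
  have H (fv ft fa p1 p2 : R) : ft - fa = (t - 0) * p1 -> fv - ft = (1 - t) * p2 ->
    fv - fa - L = t * p1 + (1 - t) * p2 - L by lra.
  rewrite (H _ _ _ _ _ e1 e2); apply: convex_bound; rewrite ?(ltW t0) ?(ltW t1)//; exact: Ha.
- have [|c cb e1] := @segment_off a v 0 1 (lexx 0) ltr01 (lexx 1) Oa.
    by move=> c cb; apply/eqP => tc; apply: no; exists c.
  rewrite E0 E1 subr0 mul1r in e1; rewrite e1; exact: Ha.
Qed.

Lemma norm_entry_le (h : V) i : `|h 0 i| <= `|h|.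
Proof.
rewrite [leRHS]/Num.Def.normr/= mx_normrE.
exact: (le_bigmax _ (fun ij : 'I_1 * 'I_n => `|h ij.1 ij.2|) (ord0, i)).
Qed.

Lemma psi_sum v x : O x -> psi v x = \sum_i v 0 i * psi (delta_mx 0 i) x.
Proof.
move=> Ox; have off y : O y -> tau y != 0 ->
    psi v y = \sum_i v 0 i * psi (delta_mx 0 i) y.
  move=> Oy ty; have [df Df] := fpsi Oy ty.
  rewrite -Df (derive_sum_delta v df); apply: eq_bigr => i _; by rewrite -Df.
have [tx|tx] := eqVneq (tau x) 0; last exact: off.
apply/eqP; rewrite -subr_eq0; apply/eqP.
pose F (y : V) : R^o := psi v y - \sum_i v 0 i * psi (delta_mx 0 i) y.
have cF : F y @[y --> x] --> F x.
  have cS : (\sum_i v 0 i * psi (delta_mx 0 i) y : R^o) @[y --> x] -->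
      (\sum_i v 0 i * psi (delta_mx 0 i) x : R^o).
    have C : Ck 0 O (fun y => \sum_i v 0 i * psi (delta_mx 0 i) y : R^o).
      apply: Ck_sum => // i _; apply: CkM => //; first exact: Ck_cst.
      by move=> z; exact: cpsi.
    exact: C.
  exact: cvgB (@cpsi v x Ox) cS.
apply: (dense_off oO stau De Ox tx cF).
near=> y => ty; rewrite /F off ?subrr//; near: y; exact: (near_open oO Ox).
Unshelve. all: by end_near. Qed.

Lemma psi_linear x : O x -> linear (fun v => psi v x : R^o).
Proof.
move=> Ox a u v; rewrite !psi_sum// scaler_sumr -big_split/=; apply: eq_bigr => i _.
by rewrite !mxE mulrDl; congr (_ + _); exact: (esym (mulrA _ _ _)).
Qed.

(** The norm on row vectors is the maximum norm, so each of the [n] coordinates contributes at most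
    [|v| d]. *)
Lemma psi_bound x y v (d : R) : O x -> O y ->
  (forall i, `|psi (delta_mx 0 i) y - psi (delta_mx 0 i) x| <= d) ->
  `|psi v y - psi v x| <= n%:R * (`|v| * d).
Proof.
move=> Ox Oy H; rewrite !psi_sum// -sumrB (le_trans (ler_norm_sum _ _ _))//.
rewrite -[n in n%:R]card_ord -sumr_const mulr_suml; apply: ler_sum => i _.
by rewrite mul1r -mulrBr normrM ler_pM ?norm_entry_le.
Qed.

(* Any displacement is the sum of two displacements transversal to the
   hypersurface, along each of which it is crossed at most once; the mean value
   theorem applies on either side of the crossing. *)
Lemma differentiable_across x : O x ->
  differentiable f x /\ forall v, 'D_v f x = psi v x.
Proof.
move=> Ox; have [tx|tx] := eqVneq (tau x) 0; last exact: fpsi.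
have [d dE] : exists d : {linear V -> R^o}, (d : V -> R^o) = (fun v => psi v x).
  pose dM := GRing.isLinear.Build _ _ _ _ _ (psi_linear Ox).
  pose d : {linear V -> R^o} := HB.pack (fun v : V => psi v x : R^o) dM.
  by exists d.
suff [df Df] : differentiable f x /\ 'd f x = d :> (V -> R^o).
  by split=> // v; rewrite deriveE// Df dE.
have cd : continuous d.
  move=> v; have -> : (d : V -> R^o) = (fun v => \sum_i v 0 i * psi (delta_mx 0 i) x : R^o).
    by rewrite dE; apply/funext => u; exact: psi_sum.
  have C : Ck 0 setT (fun v : V => \sum_i v 0 i * psi (delta_mx 0 i) x : R^o).
    apply: Ck_sum => [|i _]; first exact: openT.
    by apply: CkM; [exact: openT|exact: Ck_coord|exact: Ck_cst].
  exact: C.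
apply: (diff_eps cd) => eps eps0.
(* Near [x] one has [|D_h tau| <= B |h|] and [|D_e tau| >= c]. With [v1 = C |h| e] this gives
   [|D_v1 tau| >= (B + 1) |h|], more than [|D_h tau|], so [v2 = h - v1] is transversal as well. *)
pose B := \sum_i (`|'D_(delta_mx 0 i) tau x| + 1).
pose c := `|'D_e tau x| / 2.
have c0 : 0 < c by rewrite divr_gt0// normr_gt0; exact: De.
have B0 : 0 <= B by apply: sumr_ge0 => i _; rewrite addr_ge0.
pose C := (B + 1) / c.
have C0 : 0 < C by rewrite divr_gt0// ltr_wpDl.
(* [K |h| = |h| + |v1|] bounds [v1], [v2] and the distance from [x] of the broken path. *)
pose K := 1 + C * `|e|.
have K1 : 1 <= K by rewrite lerDl mulr_ge0// ltW.
have K0 : 0 < K by rewrite (lt_le_trans _ K1).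
(* The two errors add up to at most [n (|v1| + |v2|) d1 <= n (2 K |h|) d1]; using [n + 1] keeps the
   denominator positive and leaves [eps |h|]. *)
pose d1 := eps / (2 * K * (n%:R + 1)).
have n0 : 0 < n%:R + 1 :> R by rewrite ltr_wpDl.
have d10 : 0 < d1 by rewrite divr_gt0// !mulr_gt0.
pose P y := [/\ O y, forall i, `|'D_(delta_mx 0 i) tau y| <= `|'D_(delta_mx 0 i) tau x| + 1,
   c <= `|'D_e tau y| & forall i, `|psi (delta_mx 0 i) y - psi (delta_mx 0 i) x| <= d1].
have cD v : ('D_v tau y) @[y --> x] --> 'D_v tau x.
  exact: (smooth_continuous (smooth_derive v stau) Ox).
have nP : \forall y \near x, P y.
  have n1 : \forall y \near x, forall i : 'I_n, `|'D_(delta_mx 0 i) tau y| <=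
      `|'D_(delta_mx 0 i) tau x| + 1.
    apply: (@filter_forall _ _ (fun i y => `|'D_(delta_mx 0 i) tau y| <= `|'D_(delta_mx
        0 i) tau x| + 1) (nbhs x)) => i.
    have /(@cvgrPdist_lt _ _ _ (nbhs x))/(_ _ ltr01) := cD (delta_mx 0 i).
    apply: filterS => y h; rewrite -lerBlDl; apply: le_trans (lerB_dist _ _) _.
    by rewrite distrC ltW.
  have n2 : \forall y \near x, c <= `|'D_e tau y|.
    have /(@cvgrPdist_lt _ _ _ (nbhs x))/(_ _ c0) := cD e; apply: filterS => y h.
    have := lerB_dist ('D_e tau x) ('D_e tau y).
    have E : `|'D_e tau x| = c + c by rewrite /c -splitr.
    rewrite E; move: h; set p := `|_ - _| => h; move: (`|'D_e tau y|) => q; lra.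
  have n3 : \forall y \near x, forall i : 'I_n, `|psi (delta_mx 0 i) y - psi (delta_mx
      0 i) x| <= d1.
    apply: (@filter_forall _ _ (fun i y => `|psi (delta_mx 0 i) y - psi (delta_mx 0 i)
        x| <= d1) (nbhs x)) => i.
    have /(@cvgrPdist_lt _ _ _ (nbhs x))/(_ _ d10) := @cpsi (delta_mx 0 i) x Ox.
    by apply: filterS => y h; rewrite distrC ltW.
  near=> y; split; [near: y; exact: (near_open oO Ox)|near: y; exact: n1|near: y;
      exact: n2|near: y; exact: n3].
have /nbhs_ballP[r /= r0 rP] := nP.
have Pball z : `|z| < r -> P (x + z).
  by move=> zr; apply: rP; rewrite -ball_normE /= opprD addNKr normrN.
have rK0 : 0 < r / K by rewrite divr_gt0.
have nh : \forall h \near (0 : V), `|h| < r / K.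
  by apply/nbhs_ballP; exists (r / K) => // h; rewrite -ball_normE /= sub0r normrN.
apply: filterS nh => h hr.
have [->|h0] := eqVneq h 0.
  have d0 : d 0 = 0 := linear0 d.
  by rewrite add0r subrr d0 subr0 !normr0 mulr0.
have hp : 0 < `|h| by rewrite normr_gt0.
pose v1 := (C * `|h|) *: e; pose v2 := h - v1.
have k0 : 0 <= C * `|h| by rewrite mulr_ge0// ltW.
have nv1 : `|v1| = C * `|e| * `|h| by rewrite normrZ (ger0_norm k0) mulrAC.
have Kh : K * `|h| < r by rewrite mulrC -ltr_pdivlMr.
have KhE : K * `|h| = `|h| + `|v1| by rewrite nv1 mulrDl mul1r.
have P1 (t : R) : 0 <= t <= 1 -> P (x + t *: v1).
  move=> /andP[t0 t1]; apply: Pball; rewrite (normrZ t v1) (ger0_norm t0).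
  apply: le_lt_trans Kh; rewrite KhE (@le_trans _ _ `|v1|)//.
    by rewrite ler_piMl.
  by rewrite lerDr.
have P2 (t : R) : 0 <= t <= 1 -> P (x + v1 + t *: v2).
  move=> /andP[t0 t1]; rewrite -addrA; apply: Pball.
  have -> : v1 + t *: v2 = t *: h + (1 - t) *: v1.
    by rewrite /v2 scalerBr scalerBl scale1r addrCA.
  rewrite (le_lt_trans (ler_normD _ _))//; apply: le_lt_trans Kh; rewrite KhE (normrZ t
      h) (normrZ (1 - t) v1).
  rewrite (ger0_norm t0) (@ger0_norm _ (1 - t)) ?subr_ge0//.
  have t1' : 1 - t <= 1 by rewrite lerBlDr lerDl.
  by apply: lerD; exact: ler_piMl.
have Dtau v y : O y -> 'D_v tau y = \sum_i v 0 i * 'D_(delta_mx 0 i) tau y.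
  by move=> Oy; apply: derive_sum_delta; exact: smooth_differentiable stau Oy.
have Dlin y a u v : O y -> 'D_(u - a *: v) tau y = 'D_u tau y - a * 'D_v tau y.
  move=> Oy; have dt := smooth_differentiable stau Oy.
  by rewrite !deriveE// linearB linearZ.
have T1 y : P y -> 'D_v1 tau y != 0.
  move=> [Oy _ h2 _]; have := Dlin y (- (C * `|h|)) 0 e Oy.
  rewrite scaleNr opprK add0r derive0 mulNr sub0r opprK => ->.
  apply: mulf_neq0; first by rewrite mulf_neq0 ?gt_eqF.
  by rewrite -normr_gt0 (lt_le_trans c0).
have T2 y : P y -> 'D_v2 tau y != 0.
  move=> [Oy h1 h2 _]; rewrite Dlin//.
  have b1 : `|'D_h tau y| <= B * `|h|.
    rewrite Dtau// (le_trans (ler_norm_sum _ _ _))// mulr_suml; apply: ler_sum => i _.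
    by rewrite normrM mulrC ler_pM ?norm_entry_le ?h1.
  have b2 : (B + 1) * `|h| <= `|C * `|h| * 'D_e tau y|.
    rewrite normrM (ger0_norm k0).
    rewrite (_ : (B + 1) * `|h| = C * `|h| * c); last by rewrite mulrAC /C divfK// gt_eqF.
    by rewrite ler_wpM2l.
  apply/negP; rewrite subr_eq0 => /eqP E; move: b1; rewrite E => b1.
  have := le_trans b2 b1; rewrite ler_pM2r// => ?; lra.
have S1 : `|f (x + v1) - f x - psi v1 x| <= n%:R * (`|v1| * d1).
  apply: segment_estimate => t /P1 Pt; [by case: Pt|exact: T1|].
  by case: Pt => Ot _ _ h4; exact: psi_bound.
have S2 : `|f (x + v1 + v2) - f (x + v1) - psi v2 x| <= n%:R * (`|v2| * d1).
  apply: segment_estimate => t /P2 Pt; [by case: Pt|exact: T2|].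
  by case: Pt => Ot _ _ h4; exact: psi_bound.
have v12 : v1 + v2 = h by rewrite addrC subrK.
have dh : d h = psi v1 x + psi v2 x.
  by rewrite -v12 linearD dE.
have nv2 : `|v2| <= K * `|h| by rewrite KhE (le_trans (ler_normB _ _)).
have nv1' : `|v1| <= K * `|h| by rewrite KhE lerDr.
have -> : h + x = x + v1 + v2 by rewrite -addrA v12 addrC.
rewrite dh.
have tri (F2 F1 F0 p1 p2 b1 b2 b : R) : `|F1 - F0 - p1| <= b1 -> `|F2 - F1 - p2| <= b2
    -> b1 + b2 <= b ->
    `|F2 - F0 - (p1 + p2)| <= b.
  move=> h1 h2 hb; apply: le_trans hb.
  rewrite (_ : _ - _ = (F1 - F0 - p1) + (F2 - F1 - p2)); last by ring.
  by rewrite (le_trans (ler_normD _ _))// lerD.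
apply: (tri _ _ _ _ _ _ _ _ S1 S2).
rewrite -mulrDr -mulrDl.
apply: (@le_trans _ _ ((n%:R + 1) * ((2 * K * `|h|) * d1))).
  apply: ler_pM => //; first by rewrite mulr_ge0 ?addr_ge0// ltW.
    by rewrite lerDl.
  rewrite ler_wpM2r ?ltW//; lra.
rewrite le_eqVlt; apply/orP; left; apply/eqP; rewrite /d1; field.
by rewrite !gt_eqF.
Unshelve. all: by end_near. Qed.

End Criterion.

(** The candidate derivative is again a quotient, of order [m + 1]. It is continuous because
    [flat_quot_derive] supplies the extra order of vanishing, and off the hypersurface it is the
    quotient rule. *)
Lemma quot_derive m w x : flat O tau m w -> O x ->
  differentiable (quot tau e m w) x /\
  forall v, 'D_v (quot tau e m w) x =
    quot tau e m.+1 (fun y => tau y * 'D_v w y - m%:R * (w y * 'D_v tau y)) x.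
Proof.
move=> fw; move: x; apply: differentiable_across.
- by move=> x Ox; exact: (quot_continuous oO stau De).
- by move=> v x Ox; apply: (quot_continuous oO stau De) => //; exact: (flat_quot_derive
    oO stau De).
move=> x Ox tx; have sw := flat_smooth fw.
have oO1 := @open_off _ _ _ _ oO stau.
have dw := smooth_differentiable sw Ox.
have dt := smooth_differentiable stau Ox.
have tm0 : tau x ^+ m != 0 by rewrite expf_neq0.
have N : \forall y \near x, w y / tau y ^+ m = quot tau e m w y.
  have E : [set y | O y /\ tau y != 0] `<=` [set y | w y / tau y ^+ m = quot tau e m w y].
    by move=> y [_ ty]; rewrite /mkset quot_off.
  exact: (near_open oO1 (conj Ox tx) E).
have dX v := derive_exp m v dt.
split.
  apply: near_differentiable N _; apply: differentiableM => //.
  by apply: differentiableV => //; exact: (dX 0).1.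
move=> v; rewrite -(near_eq_derive v N) (derive_div v dw (dX v).1 tm0) (dX v).2 quot_off//.
have H (W T a b : R) : T != 0 -> (a * T ^+ m - W * (m%:R * T ^+ m.-1 * b)) / (T ^+ m * T ^+ m) =
    (T * a - m%:R * (W * b)) / T ^+ m.+1.
  move=> T0.
  case: m {fw tm0 N dX} => [|j].
    by rewrite expr1 !expr0; field.
  have Tj : T ^+ j != 0 by rewrite expf_neq0.
  rewrite /= !exprS; move: (T ^+ j) Tj => S S0; field.
  by rewrite S0 T0.
exact: H.
Qed.

(** Derivatives of quotients are quotients of higher order, so the induction on the class C^k must
    run over all [m] and [w] at once, even though only [m = 1] is wanted in the end. *)
Lemma quot_smooth m w : flat O tau m w -> smooth O (quot tau e m w).
Proof.
move=> fw k; elim: k m w fw => [|k IH] m w fw.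
  by move=> x Ox; exact: (quot_continuous oO stau De).
split=> [x Ox|v]; first exact: (quot_derive fw Ox).1.
apply: (Ck_eq oO _ (IH _ _ (flat_quot_derive oO stau De v fw))) => x Ox.
by rewrite (quot_derive fw Ox).2.
Qed.

Lemma hadamard w : smooth O w -> (forall x, O x -> tau x = 0 -> w x = 0) ->
  exists2 h : V -> R^o, smooth O h & forall x, O x -> w x = tau x * h x.
Proof.
move=> sw w0; have fw : flat O tau 1 w by split=> // v; exact: smooth_derive.
exists (quot tau e 1 w); first exact: quot_smooth.
move=> x Ox; have [tx|tx] := eqVneq (tau x) 0; first by rewrite tx mul0r w0.
by rewrite quot_off// expr1 mulrC divfK.
Qed.

End AcrossHypersurface.

(** * The normal field in coordinates *)

Section LinearAlgebra.
Context {R : realType} {m : nat}.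
Implicit Types (mu nu u v : 'rV[R]_m) (G : 'M[R]_m).

Lemma pairingE mu v : pairing mu v = \sum_i mu 0 i * v 0 i.
Proof. by rewrite /pairing mxE; apply: eq_bigr => i _; rewrite mxE. Qed.

Lemma pairingC mu v : pairing mu v = pairing v mu.
Proof. by rewrite !pairingE; apply: eq_bigr => i _; rewrite mulrC. Qed.

Lemma pairingDl mu nu v : pairing (mu + nu) v = pairing mu v + pairing nu v.
Proof. by rewrite /pairing mulmxDl mxE. Qed.

Lemma pairingZl a mu v : pairing (a *: mu) v = a * pairing mu v.
Proof. by rewrite /pairing -scalemxAl mxE. Qed.

Lemma pairingDr mu u v : pairing mu (u + v) = pairing mu u + pairing mu v.
Proof. by rewrite !(pairingC mu) pairingDl. Qed.

Lemma pairingZr a mu v : pairing mu (a *: v) = a * pairing mu v.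
Proof. by rewrite !(pairingC mu) pairingZl. Qed.

Lemma pairingBr mu u v : pairing mu (u - v) = pairing mu u - pairing mu v.
Proof. by rewrite pairingDr -scaleN1r pairingZr mulN1r. Qed.

Lemma pairing0l v : pairing 0 v = 0.
Proof. by rewrite /pairing mul0mx mxE. Qed.

Lemma pairing_mulmx mu v G : pairing (mu *m G) v = pairing mu (v *m G^T).
Proof. by rewrite /pairing trmx_mul trmxK mulmxA. Qed.

Lemma bil_pairing G u v : bil G u v = pairing (u *m G) v.
Proof. by []. Qed.

Lemma pairing_delta mu i : pairing mu (delta_mx 0 i) = mu 0 i.
Proof.
rewrite pairingE (bigD1 i)//= !mxE !eqxx mulr1 big1 ?addr0// => j ji.
by rewrite mxE eqxx (negbTE ji) mulr0.
Qed.

Lemma pairing_eq0 mu : (forall v, pairing mu v = 0) -> mu = 0.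
Proof. by move=> H; apply/rowP => i; rewrite -pairing_delta H mxE. Qed.

(* A kernel vector supported off an index whose complementary minor is nonzero
   vanishes. *)
Lemma kernel_line G mu nu : \adj G != 0 -> mu *m G = 0 -> nu *m G = 0 ->
  mu != 0 -> exists k, nu = k *: mu.
Proof.
case: m G mu nu => [|m'] G mu nu aG muG nuG mu0.
  by case/eqP: mu0; rewrite thinmx0.
have [i [j cij]] : exists i j, cofactor G i j != 0.
  apply: contrapT => H; move/negP: aG; apply; apply/eqP/matrixP => j i.
  by rewrite !mxE; apply: contrapT => /eqP c; apply: H; exists i, j.
have key (w : 'rV[R]_m'.+1) : w *m G = 0 -> w 0 i = 0 -> w = 0.
  move=> wG wi.
  have U : row' i (col' j G) \in unitmx.
    rewrite unitmxE unitfE; apply: contraNneq cij => d0.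
    by rewrite /cofactor d0 mulr0.
  have w'0 : col' i w *m row' i (col' j G) = 0.
    apply/matrixP => a l; have /matrixP/(_ 0 (lift j l)) := wG; rewrite !mxE => E.
    rewrite -[RHS]E (bigD1_ord i)//= wi mul0r add0r.
    by apply: eq_bigr => k _; rewrite !mxE (ord1 a).
  have {}w'0 : col' i w = 0 by rewrite -(mulmxK U (col' i w)) w'0 mul0mx.
  apply/rowP => k; rewrite mxE; have [->//|ki] := eqVneq k i.
  have [k' ->] : exists k', k = lift i k'.
    by move: ki; rewrite eq_sym => /unlift_some[k' -> _]; exists k'.
  by have /rowP/(_ k') := w'0; rewrite !mxE.
have mui : mu 0 i != 0 by apply: contraNneq mu0 => /(key _ muG) ->.
exists (nu 0 i / mu 0 i); apply/eqP; rewrite -subr_eq0; apply/eqP/key.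
  by rewrite mulmxBl nuG -scalemxAl muG scaler0 subr0.
by rewrite !mxE divfK// subrr.
Qed.

End LinearAlgebra.

Section Gradient.
Context {R : realType} {m : nat}.
Notation V := 'rV[R]_m.
Implicit Types (f g : V -> R^o) (x v : V).

Definition gradient f x : V := \row_i 'D_(delta_mx 0 i) f x.

Lemma derive_gradient f x v : differentiable f x -> 'D_v f x = pairing (gradient f x) v.
Proof.
move=> df; rewrite (derive_sum_delta v df) pairingE.
by apply: eq_bigr => i _; rewrite mxE; exact: (mulrC (v 0 i)).
Qed.

Lemma smooth_gradient (O : set V) f : open O -> smooth O f -> smooth O (gradient f).
Proof.
move=> oO sf; apply: smooth_mx => // i j.
apply: (@smooth_eq _ _ _ _ (fun x => 'D_(delta_mx 0 j) f x)) => //.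
  by move=> x _; rewrite mxE.
exact: smooth_derive.
Qed.

Lemma smooth_pairing (O : set V) (F H : V -> V) : open O ->
  smooth O F -> smooth O H -> smooth O (fun x => pairing (F x) (H x) : R^o).
Proof.
move=> oO sF sH; apply: (@smooth_entry _ _ _ _ _ (fun x => F x *m (H x)^T)) => //.
by apply: smooth_mulmx => //; exact: smooth_tr.
Qed.

Lemma gradient_div f g x : differentiable f x -> differentiable g x -> g x != 0 ->
  gradient (fun y => f y / g y : R^o) x =
  (g x)^-1 *: gradient f x - (f x / (g x * g x)) *: gradient g x.
Proof.
move=> df dg g0; apply/rowP => i; rewrite !mxE (derive_div _ df dg g0).
have H (a b c d : R) : b != 0 -> (c * b - a * d) / (b * b) = b^-1 * c + - (a / (b * b) * d).
  by move=> b0; field.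
exact: H.
Qed.

End Gradient.

Section LocalModel.
Context {R : realType} {m : nat}.
Notation V := 'rV[R]_m.
Variables (O : set V) (G : V -> 'M[R]_m) (e : V).
Let tau : V -> R^o := fun x => \det (G x).
Hypothesis oO : open O.
Hypothesis sG : smooth O G.
Hypothesis De : forall x, O x -> 'D_e tau x != 0.

Lemma smooth_tau : smooth O tau.
Proof. exact: smooth_det. Qed.
Let stau := smooth_tau.

Lemma dense_eq p q (W : set V) (F H : V -> 'M[R]_(p, q)) : open W -> W `<=` O ->
  smooth W F -> smooth W H -> (forall x, W x -> tau x != 0 -> F x = H x) ->
  forall x, W x -> F x = H x.
Proof.
move=> oW WO sF sH FH x Wx; apply/matrixP => i j.
apply: (dense_off_eq oW (smooth_sub WO stau) (fun y Wy => De (WO y Wy))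
  (smooth_entry i j oW sF) (smooth_entry i j oW sH)) Wx => y Wy ty.
by rewrite FH.
Qed.

Lemma hadamard_mx p q (W : set V) (F : V -> 'M[R]_(p, q)) : open W -> W `<=` O ->
  smooth W F -> (forall x, W x -> tau x = 0 -> F x = 0) ->
  exists2 H : V -> 'M[R]_(p, q), smooth W H & forall x, W x -> F x = tau x *: H x.
Proof.
move=> oW WO sF F0.
have H i j : exists2 h : V -> R^o, smooth W h & forall x, W x -> F x i j = tau x * h x.
  apply: (hadamard oW (smooth_sub WO stau) (fun y Wy => De (WO y Wy))).
    exact: smooth_entry.
  by move=> x Wx tx; rewrite F0// mxE.
exists (fun x => \matrix_(i, j) s2val (cid2 (H i j)) x).
  apply: smooth_mx => // i j.
  apply: (@smooth_eq _ _ _ _ (s2val (cid2 (H i j)))) => //; last exact: s2valP.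
  by move=> x _; rewrite mxE.
move=> x Wx; apply/matrixP => i j; rewrite !mxE; exact: (s2valP' (cid2 (H i j))).
Qed.

Hypothesis symG : forall x, O x -> (G x)^T = G x.
Hypothesis radG : forall x, O x -> tau x = 0 -> gradient tau x *m G x = 0.

Lemma gradient_tau_neq0 x : O x -> gradient tau x != 0.
Proof.
move=> Ox; apply: contraNneq (De Ox) => g0.
by rewrite derive_gradient ?g0 ?pairing0l//; exact: smooth_differentiable stau Ox.
Qed.

Lemma sym_adj x : O x -> (\adj (G x))^T = \adj (G x).
Proof. by move=> Ox; rewrite trmx_adj symG. Qed.

(** The last identity comes from [d tau G adj(G) = tau d tau], cancelling [tau] off the hypersurface
    and passing to the limit. It shows that [adj(G)] is nonzero everywhere, so [G] has rank at least
    m - 1. *)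
Lemma gradient_field : exists Y : V -> V, [/\ smooth O Y,
  forall x, O x -> gradient tau x *m G x = tau x *: Y x &
  forall x, O x -> Y x *m \adj (G x) = gradient tau x].
Proof.
have sg := smooth_gradient oO stau.
have [|||Y sY YE] := @hadamard_mx 1 m O (fun x => gradient tau x *m G x) oO.
- by [].
- by apply: smooth_mulmx.
- exact: radG.
exists Y; split=> // x Ox.
apply: (@dense_eq 1 m O (fun x => Y x *m \adj (G x)) (gradient tau) oO) Ox => //.
  by apply: smooth_mulmx => //; exact: smooth_adj.
move=> y Oy ty; apply: (scalerI ty).
by rewrite scalemxAl -YE// -mulmxA mul_mx_adj mul_mx_scalar.
Qed.

Section WithField.
Variable Y : V -> V.
Hypothesis sY : smooth O Y.
Hypothesis YG : forall x, O x -> gradient tau x *m G x = tau x *: Y x.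
Hypothesis YA : forall x, O x -> Y x *m \adj (G x) = gradient tau x.

Lemma radical_line x mu : O x -> tau x = 0 -> mu *m G x = 0 ->
  exists k, mu = k *: gradient tau x.
Proof.
move=> Ox tx muG; apply: (kernel_line _ (radG Ox tx) muG (gradient_tau_neq0 Ox)).
by apply: contraNneq (gradient_tau_neq0 Ox) => a0; rewrite -YA// a0 mulmx0.
Qed.

(** On the hypersurface [adj(G) G = 0], so each row of [adj(G)] lies in the kernel line and is a
    multiple of [d tau], which kills [v]. *)
Lemma tangent_adj x v : O x -> tau x = 0 -> pairing (gradient tau x) v = 0 ->
  v *m \adj (G x) = 0.
Proof.
move=> Ox tx gv; rewrite -sym_adj//; apply/rowP => i.
have rG : row i (\adj (G x)) *m G x = 0.
  by rewrite -row_mul mul_adj_mx -/(tau x) tx -scalemx1 scale0r row0.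
have [k rk] := radical_line Ox tx rG.
have -> : (v *m (\adj (G x))^T) 0 i = pairing v (row i (\adj (G x))).
  by rewrite mxE pairingE; apply: eq_bigr => j _; rewrite !mxE.
by rewrite rk pairingZr pairingC gv mulr0 mxE.
Qed.

Lemma pairing_field_neq0 x : O x -> tau x = 0 -> pairing (gradient tau x) (Y x) != 0.
Proof.
move=> Ox tx; apply: contraNneq (gradient_tau_neq0 Ox) => gY.
by rewrite -YA// tangent_adj.
Qed.

End WithField.
End LocalModel.

(** * The Lie bracket in coordinates *)

Section Bracket.
Context {R : realType} {m : nat}.
Notation V := 'rV[R]_m.
Implicit Types (f : V -> R^o) (F H X Z : V -> V) (x u v : V).

Lemma derive_pairing F H x v : differentiable F x -> differentiable H x ->
  'D_v (fun y => pairing (F y) (H y) : R^o) x =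
  pairing ('D_v F x) (H x) + pairing (F x) ('D_v H x).
Proof.
move=> dF dH.
have -> : (fun y => pairing (F y) (H y) : R^o) =
    \sum_(i < m) (fun y => F y 0 i * H y 0 i : R^o).
  by apply/funext => y; rewrite fct_sumE pairingE.
have d i : differentiable (fun y => F y 0 i * H y 0 i : R^o) x.
  by apply: differentiableM; exact: differentiable_entry.
rewrite derive_sum; last by move=> i; exact: diff_derivable.
rewrite !pairingE -big_split/=; apply: eq_bigr => i _.
rewrite (derive_mul v (differentiable_entry 0 i dF) (differentiable_entry 0 i dH)).
rewrite !derive_entry// addrC; congr (_ + _); exact: mulrC.
Qed.

Lemma hessian (O : set V) f x u v : open O -> smooth O f -> O x ->
  pairing ('D_v (gradient f) x) u = 'D_u ('D_v f) x.
Proof.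
move=> oO sf Ox.
have sD := smooth_derive v sf.
rewrite (derive_gradient u (smooth_differentiable sD Ox)) !pairingE.
apply: eq_bigr => i _; congr (_ * _).
rewrite (derive_entry v 0 i (smooth_differentiable (smooth_gradient oO sf) Ox)) mxE.
rewrite -(derive_sym v _ oO sf Ox).
by congr ('D_v _ x); apply/funext => y; rewrite mxE.
Qed.

(** [[Z, X] f = Z (X f) - X (Z f)]: the two Hessian terms cancel by symmetry of second
    derivatives. *)
Lemma pairing_bracket (O : set V) f X Z x : open O -> smooth O f ->
  smooth O X -> smooth O Z -> O x ->
  pairing (gradient f x) ('D_(Z x) X x - 'D_(X x) Z x) =
  'D_(Z x) (fun y => pairing (gradient f y) (X y) : R^o) x -
  'D_(X x) (fun y => pairing (gradient f y) (Z y) : R^o) x.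
Proof.
move=> oO sf sX sZ Ox.
have dg := smooth_differentiable (smooth_gradient oO sf) Ox.
have dX := smooth_differentiable sX Ox; have dZ := smooth_differentiable sZ Ox.
have h1 := hessian (X x) (Z x) oO sf Ox.
have h2 := hessian (Z x) (X x) oO sf Ox.
have h : pairing ('D_(Z x) (gradient f) x) (X x) = pairing ('D_(X x) (gradient f) x) (Z x).
  exact: etrans h1 (etrans (derive_sym (X x) (Z x) oO sf Ox) (esym h2)).
have H (a b c d : R) : c = d -> a - b = (c + a) - (d + b) by move=> ->; ring.
apply: etrans (pairingBr _ _ _) _.
have E (a b c d : R) : a = b -> c = d -> a - c = b - d by move=> -> ->.
apply: etrans _ (esym (E _ _ _ _ (derive_pairing (Z x) dg dX) (derive_pairing (X x) dg dZ))).
exact: H h.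
Qed.

End Bracket.

Section NormalModel.
Context {R : realType} {m : nat}.
Notation V := 'rV[R]_m.
Variables (O : set V) (G : V -> 'M[R]_m) (e : V).
Let tau : V -> R^o := fun x => \det (G x).
Hypothesis oO : open O.
Hypothesis sG : smooth O G.
Hypothesis De : forall x, O x -> 'D_e tau x != 0.
Hypothesis symG : forall x, O x -> (G x)^T = G x.
Hypothesis radG : forall x, O x -> tau x = 0 -> gradient tau x *m G x = 0.
Let stau : smooth O tau := smooth_tau oO sG.

(* [sigma] is the equation of the hypersurface normalised so that its rescaled
   gradient [N], i.e. the gradient of [ln sigma], satisfies [N sigma = 1]
   there. *)
Lemma normal_model : exists (U : set V) (sigma : V -> R^o) (N : V -> V),
  [/\ open U, U `<=` O, forall x, O x -> tau x = 0 -> U x,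
      smooth U sigma & smooth U N] /\
  [/\ forall x, U x -> (sigma x = 0 <-> tau x = 0),
      forall x, U x -> gradient sigma x *m G x = sigma x *: N x,
      forall x, U x -> tau x = 0 ->
        pairing (gradient sigma x) (N x) = 1 /\
        (exists k, gradient tau x = k *: gradient sigma x),
      forall x mu, U x -> tau x = 0 -> mu *m G x = 0 ->
        exists k, mu = k *: gradient sigma x &
      forall (W : set V) (T : V -> V), open W -> W `<=` U -> smooth W T ->
        (forall x, W x -> tau x = 0 -> pairing (gradient sigma x) (T x) = 0) ->
        exists2 eta : V -> V, smooth W eta & forall x, W x -> T x = eta x *m G x].
Proof.
have [Y [sY YG YA]] := gradient_field oO sG De radG.
pose b x : R^o := pairing (gradient tau x) (Y x).
have sb : smooth O b by apply: smooth_pairing => //; exact: smooth_gradient.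
have b0 x : O x -> tau x = 0 -> b x != 0.
  by move=> Ox tx; exact: (pairing_field_neq0 oO sG De symG radG YA Ox tx).
pose U := [set x | O x /\ b x != 0].
have oU : open U by exact: open_off oO sb.
have UO : U `<=` O by move=> x [].
pose sigma x : R^o := tau x / b x.
(* This is [G(d sigma) / sigma] written without division by [tau], since
   [d sigma = d tau / b - (tau / b^2) db]. *)
pose N x : V := Y x - (b x)^-1 *: (gradient b x *m G x).
have stU := smooth_sub UO stau; have sbU := smooth_sub UO sb.
have bU x : U x -> b x != 0 by case.
have ss : smooth U sigma by exact: smooth_div.
have sN : smooth U N.
  apply: smoothD => //; first exact: smooth_sub UO sY.
  apply: (@smooth_eq _ _ _ _ (fun x => (- (b x)^-1 : R^o) *: (gradient b x *m G x))) => //.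
    by move=> x _; rewrite scaleNr.
  apply: smoothZ => //; first by apply: smoothN => //; exact: smoothV.
  by apply: smooth_mulmx => //; [exact: smooth_gradient|exact: smooth_sub UO sG].
have gs x : U x -> gradient sigma x = (b x)^-1 *: gradient tau x - (tau x / (b x * b
    x)) *: gradient b x.
  move=> Ux; apply: gradient_div; [exact: smooth_differentiable stU Ux|exact:
      smooth_differentiable sbU Ux|exact: bU].
have gs0 x : U x -> tau x = 0 -> gradient sigma x = (b x)^-1 *: gradient tau x.
  by move=> Ux tx; rewrite gs// tx mul0r scale0r subr0.
exists U, sigma, N; split.
  by split=> // x Ox tx; split=> //; exact: b0.
split=> [x Ux|x Ux|x Ux tx|x mu Ux tx muG|W T oW WU sT T0].
- rewrite /sigma; split=> [/eqP|->]; last by rewrite mul0r.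
  by rewrite mulf_eq0 invr_eq0 (negbTE (bU _ Ux)) orbF => /eqP.
- rewrite gs// mulmxBl -!scalemxAl (YG _ (UO _ Ux)) /sigma /N scalerBr !scalerA.
  have bx := bU _ Ux.
  congr (_ - _); last by congr (_ *: _); rewrite invfM mulrA.
  by congr (_ *: _); rewrite mulrC.
- split.
    (* On the hypersurface [d sigma(N) = d tau(Y) / b = 1]; the correction [G(db) / b] drops out
       because [d tau] lies in the radical. *)
    rewrite gs0// pairingZl /N pairingBr pairingZr -/(b x).
    have -> : pairing (gradient tau x) (gradient b x *m G x) = 0.
      rewrite pairingC pairing_mulmx (symG (UO _ Ux)) (radG (UO _ Ux) tx).
      by rewrite pairingC pairing0l.
    by rewrite mulr0 subr0 mulVf// bU.
  by exists (b x); rewrite gs0// scalerA divff ?scale1r// bU.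
- have [k ->] := radical_line oO sG De radG YA (UO _ Ux) tx muG.
  by exists (k * b x); rewrite gs0// scalerA -mulrA divff ?mulr1// bU.
- have WO : W `<=` O by move=> x /WU/UO.
  have sGW := smooth_sub WO sG.
  (* The form to be found is [T G^(-1) = T adj(G) / tau]. For [T] tangent to the hypersurface,
     [T adj(G)] vanishes there and the division is smooth. *)
  have [||H sH HE] := @hadamard_mx _ _ O G e oO sG De 1 m W (fun x => T x *m \adj (G x)) oW WO.
  + by apply: smooth_mulmx => //; exact: smooth_adj.
  + move=> x Wx tx; apply: (tangent_adj oO sG De symG radG YA (WO _ Wx) tx).
    have := T0 x Wx tx; rewrite gs0//; last exact: WU.
    rewrite pairingZl => /eqP; rewrite mulf_eq0 invr_eq0 => /orP[b0'|/eqP//].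
    by move: (bU _ (WU _ Wx)); rewrite b0'.
  exists H => // x Wx.
  apply: (@dense_eq _ _ O G e oO sG De 1 m W T (fun x => H x *m G x) oW WO sT _ _ x Wx)
      => [|y Wy ty].
    exact: smooth_mulmx.
  apply: (scalerI ty); rewrite -/(tau y) scalemxAl -(HE _ Wy) -mulmxA mul_adj_mx
      mul_mx_scalar//.
Qed.

End NormalModel.

(** * Koszul's formula near the hypersurface *)

Section BetaFormula.
Context {R : realType} {m : nat}.
Notation V := 'rV[R]_m.
Variables (W : set V) (tau : V -> R^o) (e : V).
Hypothesis oW : open W.
Hypothesis stau : smooth W tau.
Hypothesis De : forall x, W x -> 'D_e tau x != 0.
Variables (sigma zeta : V -> R^o) (Z X eta : V -> V) (gh : V -> 'M[R]_m).
Hypothesis ssigma : smooth W sigma.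
Hypothesis szeta : smooth W zeta.
Hypothesis sZ : smooth W Z.
Hypothesis sX : smooth W X.
Hypothesis seta : smooth W eta.
Hypothesis sigma0 : forall x, W x -> (sigma x = 0 <-> tau x = 0).
Hypothesis ghZ : forall x, W x -> tau x != 0 ->
  sigma x *: (Z x *m gh x) = zeta x *: gradient sigma x + sigma x *: eta x.
Hypothesis ZX0 : forall x, W x -> tau x != 0 -> bil (gh x) (Z x) (X x) = 0.
Hypothesis zeta0 : forall x, W x -> zeta x != 0.

Let s : V -> R^o := fun y => pairing (gradient sigma y) (Z y).
Let q : V -> R^o := fun y => zeta y * s y + sigma y * pairing (eta y) (Z y).
Hypothesis q0 : forall x, W x -> q x != 0.

Let B x : V := 'D_(Z x) X x - 'D_(X x) Z x.
Let r : V -> R^o := fun y => pairing (eta y) (X y) / zeta y.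

(* [F] is the quotient of [(nabla_Z Z, X)] by [(Z, Z)], computed with Koszul's
   formula from [sigma g(Z, .) = zeta d sigma + sigma eta]; in particular
   [q = sigma g(Z, Z)]. *)
Let F : V -> R^o := fun x =>
  - (1 / 2) * (pairing (gradient q x) (X x) / q x) - 1 / 2 * r x -
  (zeta x * pairing (gradient sigma x) (B x) + sigma x * pairing (eta x) (B x)) / q x.

Let ss : smooth W s.
Proof. by apply: smooth_pairing => //; exact: smooth_gradient. Qed.

Let sq : smooth W q.
Proof.
apply: smoothD => //; first exact: smoothM.
by apply: smoothM => //; exact: smooth_pairing.
Qed.

Let sr : smooth W r.
Proof. by apply: smooth_div => //; exact: smooth_pairing. Qed.

Lemma smooth_bracket : smooth W B.
Proof.
apply: (@smooth_eq _ _ _ _ (fun x => Z x *m jacobian X x + (-1 : R^o) *: (X x *m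
    jacobian Z x))) => //.
  move=> x Wx; rewrite scaleN1r /B.
  rewrite (deriveEjacobian _ (smooth_differentiable sX Wx)).
  by rewrite (deriveEjacobian _ (smooth_differentiable sZ Wx)).
have sJ H : smooth W H -> smooth W (jacobian H) by exact: smooth_jacobian.
apply: smoothD => //; first by apply: smooth_mulmx => //; exact: sJ.
by apply: smoothZ => //; [exact: smooth_cst|apply: smooth_mulmx => //; exact: sJ].
Qed.

Let sF : smooth W F.
Proof.
have sg f : smooth W f -> smooth W (gradient f) by exact: smooth_gradient.
have sB := smooth_bracket.
apply: smoothB => //; last first.
  apply: smooth_div => //; apply: smoothD => //; apply: smoothM => //; apply:
      smooth_pairing => //.
  exact: sg.
apply: smoothB => //; last by apply: smoothM => //; exact: smooth_cst.
apply: smoothM => //; first exact: smooth_cst.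
by apply: smooth_div => //; apply: smooth_pairing => //; exact: sg.
Qed.

Let off_neq0 x : W x -> tau x != 0 -> sigma x != 0.
Proof. by move=> Wx; apply: contra_neq => /(sigma0 Wx).1. Qed.

Let pair_off x v : W x -> tau x != 0 ->
  sigma x * bil (gh x) (Z x) v = zeta x * pairing (gradient sigma x) v + sigma x *
      pairing (eta x) v.
Proof. by move=> Wx tx; rewrite bil_pairing -pairingZl ghZ// pairingDl !pairingZl. Qed.

Let norm_off x : W x -> tau x != 0 -> bil (gh x) (Z x) (Z x) = q x / sigma x.
Proof.
move=> Wx tx; have s0 := off_neq0 Wx tx.
by apply: (mulfI s0); rewrite pair_off// [RHS]mulrC divfK.
Qed.

(** Off the hypersurface [g(Z, X) = 0] reads [zeta d sigma(X) + sigma eta(X) = 0], and density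
    extends this. So [- r] is the smooth extension of [X (ln sigma)]. *)
Lemma derive_sigma_X x : W x -> pairing (gradient sigma x) (X x) = - (sigma x * r x).
Proof.
apply: (@dense_off_eq R m W tau e oW stau De (fun x => pairing (gradient sigma x) (X
    x)) (fun x => - (sigma x * r x))).
- by apply: smooth_pairing => //; exact: smooth_gradient.
- by apply: smoothN => //; exact: smoothM.
move=> y Wy ty; have := pair_off (X y) Wy ty.
rewrite ZX0// mulr0 /r => E; have z0 := zeta0 Wy.
apply: (mulfI z0).
have H (z a b c : R) : z != 0 -> 0 = z * a + b * c -> z * a = z * - (b * (c / z)).
  move=> z0' h; have -> : z * - (b * (c / z)) = - (b * c) by field.
  lra.
exact: H.
Qed.

(** Both poles cancel: [g(Z, Z) = q / sigma], and [X (1 / sigma)] is again a smooth multiple of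
    [1 / sigma] by [derive_sigma_X]. At [sigma = 0] the bracket term contributes [r + (X s) / s],
    against [- r / 2] and minus half the logarithmic derivative of [zeta s]. *)
Lemma beta_formula : smooth W F /\
  (forall x, W x -> tau x != 0 -> bil (gh x) (Z x) (Z x) != 0 /\
    F x * bil (gh x) (Z x) (Z x) =
    - (1 / 2) * 'D_(X x) (fun y => bil (gh y) (Z y) (Z y) : R^o) x -
    bil (gh x) (Z x) (B x)) /\
  (forall x, W x -> tau x = 0 ->
    F x = r x / 2 + ('D_(X x) s x / s x - 'D_(X x) zeta x / zeta x) / 2).
Proof.
split; first exact: sF.
split=> x Wx tx; have z0 := zeta0 Wx; have qx := q0 Wx;
  have dsig := smooth_differentiable ssigma Wx; have dq := smooth_differentiable sq Wx.
- have s0 := off_neq0 Wx tx.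
  have N : \forall y \near x, q y / sigma y = bil (gh y) (Z y) (Z y).
    have E : [set y | W y /\ tau y != 0] `<=` [set y | q y / sigma y = bil (gh y) (Z y) (Z y)].
      by move=> y [Wy ty]; rewrite /mkset norm_off.
    exact: (near_open (open_off oW stau) (conj Wx tx) E).
  rewrite norm_off//; split; first by rewrite mulf_neq0// invr_eq0.
  rewrite -(near_eq_derive (X x) N) (derive_div (X x) dq dsig s0).
  have pB := pair_off (B x) Wx tx.
  (* This produces the term [- r / 2] of [F], when [q / sigma] is differentiated along [X]. *)
  have dX : 'D_(X x) sigma x = - (sigma x * r x).
    by rewrite derive_gradient// derive_sigma_X.
  rewrite dX (derive_gradient _ dq) /F.
  have H (S Q D rr c d b : R) : S != 0 -> Q != 0 -> S * b = c + d ->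
     (- (1 / 2) * (D / Q) - 1 / 2 * rr - (c + d) / Q) * (Q / S) =
     - (1 / 2) * ((D * S - Q * - (S * rr)) / (S * S)) - b.
    move=> S0 Q0 h; have -> : b = (c + d) / S by rewrite -h mulrC mulKf.
    by field; rewrite S0 Q0.
  exact: H.
- have s0 : sigma x = 0 by exact: (sigma0 Wx).2.
  have dr := smooth_differentiable sr Wx; have ds := smooth_differentiable ss Wx.
  have dz := smooth_differentiable szeta Wx.
  have deZ := smooth_differentiable (smooth_pairing oW seta sZ) Wx.
  have dsr := differentiableM dsig dr.
  (* [X sigma] vanishes on the hypersurface, but its transversal derivative does not:
     [Z (- sigma r) = - r Z sigma] where [sigma = 0]. *)
  have E1 : 'D_(Z x) (fun y => pairing (gradient sigma y) (X y) : R^o) x = - (r x * s x).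
    have N : \forall y \near x, -1 * (sigma y * r y) = pairing (gradient sigma y) (X y).
      apply: (near_open oW Wx) => y Wy; rewrite /mkset derive_sigma_X// mulN1r//.
    rewrite -(near_eq_derive (Z x) N) (derive_cmul _ _ dsr) (derive_mul _ dsig dr).
    by rewrite (derive_gradient (Z x) dsig) s0 mul0r add0r mulN1r.
  have E2 : pairing (gradient sigma x) (B x) = - (r x * s x) - 'D_(X x) s x.
    by rewrite (pairing_bracket oW ssigma sX sZ Wx) E1.
  have dX0 : 'D_(X x) sigma x = 0.
    by rewrite derive_gradient// derive_sigma_X// s0 mul0r oppr0.
  have E3 : pairing (gradient q x) (X x) = zeta x * 'D_(X x) s x + s x * 'D_(X x) zeta x.
    rewrite -derive_gradient// (derive_add _ (differentiableM dz ds) (differentiableM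
        dsig deZ)).
    rewrite (derive_mul _ dz ds) (derive_mul _ dsig deZ) dX0 s0.
    by rewrite mul0r mulr0 addr0 addr0.
  have E4 : q x = zeta x * s x by rewrite /q s0 mul0r addr0.
  have sx : s x != 0 by move: qx; rewrite E4 mulf_eq0 negb_or => /andP[].
  rewrite /F E3 E4 E2 s0.
  have H (z S a b rr p : R) : z != 0 -> S != 0 ->
    - (1 / 2) * ((z * a + S * b) / (z * S)) - 1 / 2 * rr -
      (z * (- (rr * S) - a) + 0 * p) / (z * S) = rr / 2 + (a / S - b / z) / 2.
    by move=> z0' S0; field; rewrite z0' S0.
  exact: H.
Qed.

End BetaFormula.

Section Jacobians.
Context {R : realType}.

Lemma jacobian_row n p (f : 'rV[R]_n -> 'rV[R]_p) x i : differentiable f x ->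
  row i (jacobian f x) = 'D_(delta_mx 0 i) f x.
Proof. by move=> df; rewrite rowE deriveEjacobian. Qed.

Lemma jacobian_comp n p q (f : 'rV[R]_n -> 'rV[R]_p) (h : 'rV[R]_p -> 'rV[R]_q) x :
  differentiable f x -> differentiable h (f x) ->
  jacobian (h \o f) x = jacobian f x *m jacobian h (f x).
Proof.
move=> df dh; apply/row_matrixP => i.
have dhf := differentiable_comp df dh.
rewrite row_mul (jacobian_row i df) (jacobian_row i dhf) (derive_comp _ df dh).
by rewrite deriveEjacobian.
Qed.

Lemma near_jacobian n p (f h : 'rV[R]_n -> 'rV[R]_p) x :
  (\near x, f x = h x) -> differentiable f x -> jacobian f x = jacobian h x.
Proof.
move=> fh df; apply/row_matrixP => i.
have dh := near_differentiable fh df.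
have E := near_eq_derive (delta_mx 0 i) fh.
exact: etrans (jacobian_row i df) (etrans E (esym (jacobian_row i dh))).
Qed.

Lemma jacobian_id n (x : 'rV[R]_n) : jacobian id x = 1%:M.
Proof.
apply/row_matrixP => i; rewrite jacobian_row// derive_id.
by rewrite row1.
Qed.

End Jacobians.

(** * Fields in charts *)

Section Charts.
Context {R : realType} {m : nat} {M : manifold R m}.
Implicit Types (U W : set M) (c : chart M) (x y : M).

Lemma open_coord_image c U : open U -> open (coord c @` (U `&` dom c)).
Proof.
move=> oU; rewrite openE => _ [x [Ux dx] <-]; rewrite /interior.
have n1 : \forall z \near coord c x, (coord c @` dom c) z.
  by apply: open_nbhs_nbhs; split; [exact: coord_open|exists x].
have n2 : \forall z \near coord c x, U (param c z).
  apply: (param_continuous dx); rewrite coordK//; exact: open_nbhs_nbhs.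
near=> z; have [y dy yz] : (coord c @` dom c) z by near: z.
have Uz : U (param c z) by near: z.
by exists y => //; split=> //; move: Uz; rewrite -yz coordK.
Unshelve. all: by end_near. Qed.

Lemma open_coord_preimage c (O : set 'rV[R]_m) : open O ->
  open (dom c `&` coord c @^-1` O).
Proof.
move=> oO; rewrite openE => x [dx Ox]; rewrite /interior.
have n1 : \forall y \near x, dom c y by exact: (near_open (dom_open c) dx).
have n2 : \forall y \near x, O (coord c y).
  by apply: (coord_continuous dx); exact: open_nbhs_nbhs.
by near=> y; split; near: y.
Unshelve. all: by end_near. Qed.

Lemma differentiable_transition c c' x : dom c x -> dom c' x ->
  differentiable (coord c' \o param c) (coord c x).
Proof.
move=> dx dx'; apply: smooth_differentiable (transition_smooth c c') _.
by exists x.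
Qed.

Lemma transition_comp c c' c'' x : dom c x -> dom c' x -> dom c'' x ->
  transition c c'' x = transition c c' x *m transition c' c'' x.
Proof.
move=> dx dx' dx''; rewrite /transition.
have E : (coord c' \o param c) (coord c x) = coord c' x by rewrite /= coordK.
rewrite -{1}E -jacobian_comp; last 2 first.
- exact: differentiable_transition.
- by rewrite E; exact: differentiable_transition.
apply: near_jacobian; last exact: differentiable_transition.
have oI := open_coord_image (c := c) (dom_open c').
apply: (near_open oI); first by exists x.
by move=> _ [y [dy' dy] <-] /=; rewrite !coordK.
Qed.

Lemma transition_refl c x : dom c x -> transition c c x = 1%:M.
Proof.
move=> dx; rewrite /transition -(jacobian_id (coord c x)).
apply: near_jacobian; last exact: differentiable_transition.
have oI : open (coord c @` dom c) by exact: coord_open.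
apply: (near_open oI); first by exists x.
by move=> _ [y dy <-] /=; rewrite coordK.
Qed.

Lemma transitionK c c' x : dom c x -> dom c' x ->
  transition c c' x *m transition c' c x = 1%:M.
Proof. by move=> dx dx'; rewrite -transition_comp// transition_refl. Qed.

Lemma smooth_chart_change p q c c' U (f : 'rV[R]_m -> 'M[R]_(p, q)) : open U ->
  smooth (coord c @` (U `&` dom c)) f -> U `<=` dom c ->
  smooth (coord c' @` (U `&` dom c')) (fun z => f (coord c (param c' z))).
Proof.
move=> oU sf Uc.
apply: (@smooth_comp_mx _ _ _ _ _ _ (coord c @` (U `&` dom c)) (coord c \o param c')) sf.
- exact: open_coord_image.
- exact: open_coord_image.
- move=> _ [x [Ux dx'] <-] /=; rewrite coordK//; exists x => //.
  by split=> //; exact: Uc.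
- apply: smooth_sub (transition_smooth c' c) => _ [x [Ux dx'] <-].
  by exists x => //; split=> //; exact: Uc.
Qed.

Lemma smooth_fun_of_chart c U (f : 'rV[R]_m -> R^o) : open U -> U `<=` dom c ->
  smooth (coord c @` U) f -> smooth_fun U (fun x => f (coord c x)).
Proof.
move=> oU Uc sf c'.
have oI : open (coord c' @` (U `&` dom c')) by exact: open_coord_image.
apply: (@smooth_comp_fun _ _ _ _ (coord c @` U) (coord c \o param c')) => //.
- by move=> _ [x [Ux dx'] <-] /=; rewrite coordK//; exists x.
- apply: smooth_sub (transition_smooth c' c) => _ [x [Ux dx'] <-].
  by exists x => //; split=> //; exact: Uc.
Qed.

(** The field with components [n] in chart [c], transported to every other chart. *)
Definition field_of_chart c (n : 'rV[R]_m -> 'rV[R]_m) : vfield M :=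
  fun c' x => n (coord c x) *m transition c c' x.

Lemma field_of_chartE c n x : dom c x -> field_of_chart c n c x = n (coord c x).
Proof. by move=> dx; rewrite /field_of_chart transition_refl// mulmx1. Qed.

Lemma vector_field_of_chart c U n : open U -> U `<=` dom c ->
  smooth (coord c @` U) n -> vector_field U (field_of_chart c n).
Proof.
move=> oU Uc sn; split=> [c'|c' c'' x Ux dx' dx'']; last first.
  by rewrite /field_of_chart -mulmxA -transition_comp//; exact: Uc.
have oI : open (coord c @` ((U `&` dom c') `&` dom c)).
  by apply: open_coord_image; apply: openI => //; exact: dom_open.
have sF : smooth (coord c @` ((U `&` dom c') `&` dom c))
    (fun z : 'rV[R]_m => n z *m jacobian (coord c' \o param c) z).
  apply: (smooth_mulmx (F := n) oI).
    by apply: smooth_sub sn => _ [x [[Ux _] _] <-]; exists x.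
  apply: smooth_jacobian => //.
  by apply: smooth_sub (transition_smooth c c') => _ [x [[Ux dx'] dx] <-]; exists x.
have := smooth_chart_change c' (openI oU (dom_open c')) sF.
rewrite -setIA setIid; apply; move=> x [Ux _]; exact: Uc.
Qed.

Lemma vector_field_sub U W X : W `<=` U -> vector_field U X -> vector_field W X.
Proof.
move=> WU [sX tX]; split=> [c|c c' x /WU]; last exact: tX.
by apply: smooth_sub (sX c) => _ [x [Wx dx] <-]; exists x => //; split=> //; exact: WU.
Qed.

Lemma vector_field_chart U X c : U `<=` dom c -> vector_field U X ->
  smooth (coord c @` U) (X c \o param c).
Proof.
move=> Uc [sX _]; apply: smooth_sub (sX c) => _ [x Ux <-].
by exists x => //; split=> //; exact: Uc.
Qed.

Lemma bil_fun_chart U (g : bfield M) X Y c c' x : tensor02 U g ->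
  vector_field U X -> vector_field U Y -> U x -> dom c x -> dom c' x ->
  bil_fun g X Y c' x = bil_fun g X Y c x.
Proof.
move=> [_ tg] [_ tX] [_ tY] Ux dx dx'; rewrite /bil_fun /bil.
rewrite (tX c c')// (tY c c')// (tg c c')//.
by rewrite trmx_mul !mulmxA.
Qed.

(** The coordinate differentials of [c]. For this coframe the Gram determinant in (D1) is
    [det G]. *)
Definition chart_coframe c (a : 'I_m) : vfield M :=
  fun c' x => delta_mx 0 a *m (transition c' c x)^T.

Lemma chart_coframeP c : coframe (dom c) (chart_coframe c).
Proof.
split=> [a|c' x dx dx'].
  split=> [c'|c' c'' x dx dx' dx''].
    have oI : open (coord c' @` (dom c `&` dom c')).
      by apply: open_coord_image; exact: dom_open.
    have sJ : smooth (coord c' @` (dom c `&` dom c'))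
        (fun z => delta_mx 0 a *m (jacobian (coord c \o param c') z)^T : 'rV[R]_m).
      apply: (smooth_mulmx oI); first exact: smooth_cst.
      apply: (smooth_tr oI); apply: (smooth_jacobian oI).
      by rewrite setIC; exact: transition_smooth.
    apply: (smooth_eq oI _ sJ) => _ [x [dx dx'] <-].
    by rewrite /chart_coframe /transition /comp coordK.
  by rewrite /chart_coframe -mulmxA -trmx_mul -transition_comp.
have -> : \matrix_a chart_coframe c a c' x = (transition c' c x)^T.
  by apply/row_matrixP => a; rewrite rowK /chart_coframe -rowE.
have [Tu _] := mulmx1_unit (transitionK dx' dx).
by rewrite row_free_unit unitmx_tr.
Qed.

Lemma gram_det_chart c (gs : bfield M) x : dom c x ->
  gram_det gs (chart_coframe c) c x = \det (gs c x).
Proof.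
move=> dx; rewrite /gram_det; congr (\det _); apply/matrixP => a b.
rewrite mxE /chart_coframe transition_refl// trmx1 !mulmx1 bil_pairing pairing_delta.
by rewrite -rowE mxE.
Qed.

End Charts.

(** * The polar end in a chart *)

Section PolarGeometry.
Context {R : realType} {m : nat} {M : manifold R m}.
Variables (D : set M) (g gs : bfield M).
Implicit Types (U W : set M) (c : chart M) (x y : M).

Lemma near_coord c W x (P : 'rV[R]_m -> Prop) : open W -> W x -> dom c x ->
  (forall y, W y -> dom c y -> P (coord c y)) -> \forall z \near coord c x, P z.
Proof.
move=> oW Wx dx H; have oI := open_coord_image (c := c) oW.
apply: (near_open oI); first by exists x.
by move=> _ [y [Wy dy] <-]; exact: H.
Qed.

(** Differentiating [g(Z, X) = 0] along [Z] gives [g(nabla_Z Z, X) = - g(Z, nabla_Z X)]. Here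
    [nabla_Z X = nabla_X Z + [Z, X]], and [g(Z, nabla_X Z)] is half of [X g(Z, Z)]. *)
Lemma koszul nabla W Z X : symmetric_on (~` D) g -> levi_civita (~` D) g nabla ->
  open W -> W `<=` ~` D -> vector_field W Z -> vector_field W X ->
  (forall c y, W y -> dom c y -> bil_fun g Z X c y = 0) ->
  forall c y, W y -> dom c y ->
    dual_connection g nabla Z Z X c y =
    - (1 / 2) * dir c (bil_fun g Z Z c) y (X c y) - bil (g c y) (Z c y) (lie_bracket Z X c y).
Proof.
move=> sg hn oW WD vZ vX ZX c y Wy dy.
have E1 := lc_metric hn oW WD vZ vZ vX Wy dy.
have E2 := lc_metric hn oW WD vX vZ vZ Wy dy.
have E3 : nabla Z X c y - nabla X Z c y = lie_bracket Z X c y.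
  exact: (lc_torsion_free hn oW WD vZ vX Wy dy).
have E0 : dir c (bil_fun g Z X c) y (Z c y) = 0.
  rewrite /dir -(derive_cst (0 : R^o) (coord c y) (Z c y)).
  apply: near_eq_derive; apply: (near_coord oW Wy dy) => z Wz dz.
  by rewrite /comp coordK// ZX.
rewrite E0 in E1; rewrite /dual_connection E2 -E3.
have S : bil_fun g (nabla X Z) Z c y = bil (g c y) (Z c y) (nabla X Z c y).
  by apply: sg => //; exact: WD.
have B : bil (g c y) (Z c y) (nabla Z X c y - nabla X Z c y) =
    bil (g c y) (Z c y) (nabla Z X c y) - bil (g c y) (Z c y) (nabla X Z c y).
  by rewrite !bil_pairing pairingBr.
rewrite S B.
have H (a b k : R) : 0 = a + b -> a = - (1 / 2) * (k + k) - (b - k) by move=> h; lra.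
exact: H E1.
Qed.

Lemma tangent_derive c x v (f : 'rV[R]_m -> R^o) : dom c x ->
  differentiable f (coord c x) -> (forall y, dom c y -> D y -> f (coord c y) = 0) ->
  tangent_to D c x v -> 'D_v f (coord c x) = 0.
Proof.
move=> dx df f0 [gamma [eps [e0 g0 gD sg <-]]].
have d0 : differentiable (coord c \o gamma : R^o -> 'rV[R]_m) (0 : R^o).
  by apply: (smooth_differentiable sg); rewrite /= normr0.
rewrite derive1E -[coord c x]/(coord c x) -g0.
rewrite -g0 in df.
rewrite -(@derive_comp R R^o _ _ (coord c \o gamma) f 0 1 d0 df).
apply: etrans (derive_cst (0 : R^o) (0 : R^o) (1 : R^o)).
apply: near_eq_derive; near=> t.
have [|Dt dt] := gD t.
  near: t; apply/nbhs_ballP; exists eps => // t; rewrite -ball_normE /= sub0r normrN//.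
by rewrite /= f0.
Unshelve. all: by end_near. Qed.

Hypothesis hD : polar_end D g gs.

Lemma radical_chart c c' x mu : dom c x -> dom c' x ->
  radical (gs c' x) mu -> radical (gs c x) (mu *m (transition c c' x)^T).
Proof.
move=> dx dx' rmu nu.
have [_ tg] := pe_dual_tensor hD; move: rmu; rewrite (tg c c')//.
move/(_ (nu *m (transition c' c x)^T)); rewrite /bil.
rewrite trmx_mul trmxK !mulmxA.
by rewrite -(mulmxA _ (transition c c' x)) transitionK// mulmx1.
Qed.

(** Transporting the curve would require shrinking its time interval to fit the new chart; (D2)
    reduces tangency to the radical, which transforms linearly. *)
Lemma tangent_chart c c' x v : D x -> dom c x -> dom c' x ->
  tangent_to D c x v -> tangent_to D c' x (v *m transition c c' x).
Proof.
move=> Dx dx dx' tv; apply: (pe_radical hD Dx dx' _).1 => mu rmu.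
have := (pe_radical hD Dx dx v).2 tv _ (radical_chart dx dx' rmu).
by rewrite /pairing trmx_mul !mulmxA.
Qed.

Lemma dual_inverse c x : ~ D x -> dom c x ->
  gs c x *m g c x = 1%:M /\ (gs c x)^T = gs c x.
Proof.
move=> Dx dx.
have symg : (g c x)^T = g c x.
  apply/matrixP => i j; rewrite mxE.
  have := pe_sym hD Dx dx (delta_mx 0 j) (delta_mx 0 i).
  by rewrite !bil_pairing !pairing_delta -!rowE !mxE.
have ug : g c x \in unitmx.
  rewrite -row_free_unit -kermx_eq0; apply/eqP/row_matrixP => i; rewrite row0.
  apply: (pe_nondegenerate hD Dx dx) => v.
  by rewrite /bil -row_mul mulmx_ker row0 mul0mx mxE.
have E : gs c x = invmx (g c x).
  have := pe_dual hD Dx dx => H; apply/matrixP => i j.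
  have Eij : bil (gs c x) (delta_mx 0 i) (delta_mx 0 j) = gs c x i j.
    by rewrite bil_pairing pairing_delta -rowE mxE.
  have K (k : 'I_m) v : bil (g c x) (delta_mx 0 k *m invmx (g c x)) v = pairing
      (delta_mx 0 k) v.
    by rewrite bil_pairing mulmxKV.
  rewrite -Eij (H _ _ _ _ (K i) (K j)) K pairingC pairing_delta -rowE.
  have /matrixP/(_ j i) : (invmx (g c x))^T = invmx (g c x) by rewrite trmx_inv symg.
  by rewrite !mxE => ->.
by rewrite E mulVmx// trmx_inv symg.
Qed.

(** (D1) for the coordinate coframe. It speaks only of open sets meeting D, hence the second
    hypothesis. *)
Lemma polar_set c x : dom c x -> (dom c `&` D) !=set0 ->
  (D x <-> \det (gs c x) = 0).
Proof.
move=> dx ne; have := pe_zero_set hD (dom_open c) ne (chart_coframeP c) dx dx.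
by rewrite gram_det_chart.
Qed.

Lemma polar_regular c x : D x -> dom c x ->
  exists v, 'D_v (fun z => \det (gs c (param c z)) : R^o) (coord c x) != 0.
Proof.
move=> Dx dx; have ne : (dom c `&` D) !=set0 by exists x.
have [v] := pe_regular hD (dom_open c) ne (chart_coframeP c) dx dx Dx.
exists v; apply: contra_neq p => <-; rewrite /dir; apply: near_eq_derive.
apply: (near_coord (dom_open c) dx dx) => y dy _.
by rewrite /comp gram_det_chart coordK.
Qed.

End PolarGeometry.

Section NormalChart.
Context {R : realType} {m : nat} {M : manifold R m}.
Variables (D : set M) (g gs : bfield M).

Definition polar_det (c : chart M) : 'rV[R]_m -> R^o :=
  fun z => \det (gs c (param c z)).

(** What the global arguments use of the local model. [nc_divide] says that a field tangent to D
    along D is [G] applied to a smooth form. *)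
Record normal_chart (c : chart M) (U : set M) (e : 'rV[R]_m)
    (sigma : 'rV[R]_m -> R^o) (N : 'rV[R]_m -> 'rV[R]_m) : Prop := NormalChart {
  nc_open : open U;
  nc_dom : U `<=` dom c;
  nc_smooth_det : smooth (coord c @` U) (polar_det c);
  nc_transverse : forall z, (coord c @` U) z -> 'D_e (polar_det c) z != 0;
  nc_polar : forall x, U x -> (D x <-> polar_det c (coord c x) = 0);
  nc_sym : forall x, U x -> (gs c x)^T = gs c x;
  nc_smooth_sigma : smooth (coord c @` U) sigma;
  nc_smooth_normal : smooth (coord c @` U) N;
  nc_sigma0 : forall x, U x -> (sigma (coord c x) = 0 <-> D x);
  nc_gradient : forall x, U x ->
    gradient sigma (coord c x) *m gs c x = sigma (coord c x) *: N (coord c x);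
  nc_normal1 : forall x, U x -> D x ->
    pairing (gradient sigma (coord c x)) (N (coord c x)) = 1;
  nc_tangent : forall x v, U x -> D x ->
    (tangent_to D c x v <-> pairing (gradient sigma (coord c x)) v = 0);
  nc_divide : forall (W : set 'rV[R]_m) (T : 'rV[R]_m -> 'rV[R]_m), open W ->
    W `<=` coord c @` U -> smooth W T ->
    (forall x, W (coord c x) -> U x -> D x ->
      pairing (gradient sigma (coord c x)) (T (coord c x)) = 0) ->
    exists2 eta : 'rV[R]_m -> 'rV[R]_m, smooth W eta &
      forall z, W z -> T z = eta z *m gs c (param c z)
}.

Hypothesis hD : polar_end D g gs.

Lemma normal_chart_exists p : D p ->
  exists c U e sigma N, normal_chart c U e sigma N /\ U p.
Proof.
move=> Dp; have [c dp] := @dom_cover _ _ M p.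
have ne : (dom c `&` D) !=set0 by exists p.
have setD x : dom c x -> (D x <-> polar_det c (coord c x) = 0).
  by move=> dx; have := polar_set hD dx ne; rewrite /polar_det coordK.
have [e ep] := polar_regular hD Dp dp.
have oOm : open (coord c @` dom c) by exact: coord_open.
pose G (z : 'rV[R]_m) := gs c (param c z).
have sG : smooth (coord c @` dom c) G.
  have [sg _] := pe_dual_tensor hD.
  by apply: smooth_sub (sg c) => _ [x dx <-]; exists x.
have stau : smooth (coord c @` dom c) (polar_det c) by exact: smooth_det.
(* (D1) gives a transversal direction at [p] only; on [O] this fixed direction stays transversal. *)
pose O := [set z | (coord c @` dom c) z /\ 'D_e (polar_det c) z != 0].
have oO : open O.
  exact: (open_off oOm (smooth_derive e stau)).
have OOm : O `<=` coord c @` dom c by move=> z [].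
have sGO := smooth_sub OOm sG; have stO := smooth_sub OOm stau.
have De z : O z -> 'D_e (polar_det c) z != 0 by case.
have Op : O (coord c p) by split=> //; exists p.
(* Off D the matrix [G] is the inverse of the symmetric [g]; on D symmetry follows by density. *)
have symG z : O z -> (G z)^T = G z.
  apply: (@dense_eq _ _ O G e oO sGO De m m O (fun z => (G z)^T) G oO) => //.
    exact: smooth_tr.
  move=> y Oy ty; have [x dx xy] := OOm _ Oy; rewrite /G -xy coordK//.
  apply: (dual_inverse hD _ dx).2 => Dx.
  by move: ty; rewrite -xy -/(polar_det c (coord c x)) ((setD x dx).1 Dx) eqxx.
have tanD x v : dom c x -> D x -> tangent_to D c x v -> O (coord c x) -> 'D_v
    (polar_det c) (coord c x) = 0.
  move=> dx Dx tv Ox; apply: (tangent_derive dx (smooth_differentiable stO Ox) _ tv).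
  by move=> y dy Dy; exact: (setD y dy).1.
(* Any vector [G(u)] is annihilated by the radical, hence tangent to D by (D2), hence killed by
   [d tau]. By symmetry [G(d tau)] pairs to zero with every [u]. *)
have radG z : O z -> polar_det c z = 0 -> gradient (polar_det c) z *m G z = 0.
  move=> Oz tz; have [x dx xz] := OOm _ Oz.
  have Dx : D x by apply: (setD x dx).2; rewrite xz.
  apply: pairing_eq0 => u; rewrite pairing_mulmx symG//.
  rewrite -derive_gradient; last exact: smooth_differentiable stO Oz.
  rewrite -xz; apply: tanD => //; last by rewrite xz.
  apply: (pe_radical hD Dx dx _).1 => mu rmu.
  have Gx : G (coord c x) = gs c x by rewrite /G coordK.
  have := rmu u; rewrite bil_pairing pairing_mulmx -Gx symG// xz//.
have [U2 [sigma [N [[oU2 U2O U2D ss sN] [s0 gsig N1 rad div]]]]] :=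
  normal_model oO sGO De symG radG.
exists c, (dom c `&` coord c @^-1` U2), e, sigma, N.
set U := dom c `&` _.
have UL : coord c @` U `<=` U2 by move=> _ [x [_ Ox] <-].
have ULO : coord c @` U `<=` O by move=> z /UL/U2O.
split; last by split=> //; apply: U2D => //; exact: (setD p dp).1.
have oU : open U by exact: open_coord_preimage.
have tz x : U x -> D x -> polar_det c (coord c x) = 0 by move=> [dx _] Dx; exact: (setD x dx).1.
split.
- exact: oU.
- by move=> x [].
- exact: smooth_sub ULO stO.
- by move=> z /ULO; exact: De.
- by move=> x [dx _]; exact: setD.
- by move=> x [dx Ux]; have := symG _ (U2O _ Ux); rewrite /G coordK.
- exact: smooth_sub UL ss.
- exact: smooth_sub UL sN.
- move=> x [dx Ux]; exact: iff_trans (s0 _ Ux) (iff_sym (setD x dx)).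
- by move=> x [dx Ux]; have := gsig _ Ux; rewrite /G coordK.
- by move=> x Ux Dx; exact: (N1 _ Ux.2 (tz _ Ux Dx)).1.
- move=> x v Ux Dx; have [dx Ox] := Ux; have t0 := tz _ Ux Dx.
  have [_ [k gk]] := N1 _ Ox t0; split=> [tv|pv].
    have := tanD x v dx Dx tv (U2O _ Ox).
    rewrite derive_gradient; last exact: smooth_differentiable stO (U2O _ Ox).
    rewrite gk pairingZl => /eqP; rewrite mulf_eq0 => /orP[/eqP k0|/eqP//].
    have := De _ (U2O _ Ox); rewrite derive_gradient; last exact: smooth_differentiable
        stO (U2O _ Ox).
    by rewrite gk k0 scale0r pairing0l eqxx.
  apply: (pe_radical hD Dx dx v).1 => mu rmu.
  have [|l ->] := rad (coord c x) mu Ox t0; last by rewrite pairingZl pv mulr0.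
  by apply: pairing_eq0 => u; rewrite -bil_pairing /G coordK//; exact: rmu.
- move=> W T oW WU sT T0; apply: (div W T oW) => //; first by move=> z /WU/UL.
  move=> z Wz tz0; have [x Ux xz] := WU _ Wz; rewrite -xz.
  apply: T0 => //; first by rewrite xz.
  by apply: (setD x Ux.1).2; rewrite xz.
Qed.

End NormalChart.

(** * Existence and uniqueness of the polar-normal direction *)

Section InNormalChart.
Context {R : realType} {m : nat} {M : manifold R m}.
Variables (D : set M) (g gs : bfield M) (nabla : vfield M -> vfield M -> vfield M).
Hypothesis hD : polar_end D g gs.
Hypothesis hnabla : levi_civita (~` D) g nabla.
Variables (c : chart M) (U : set M) (e : 'rV[R]_m)
  (sigma : 'rV[R]_m -> R^o) (N : 'rV[R]_m -> 'rV[R]_m).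
Hypothesis hU : normal_chart D gs c U e sigma N.
Implicit Types (W : set M) (X Y Z V : vfield M) (x y : M) (f : 'rV[R]_m -> R^o).

Let img W : set 'rV[R]_m := coord c @` W.

Let open_img W : open W -> W `<=` U -> open (img W).
Proof.
move=> oW WU; have := open_coord_image (c := c) oW.
rewrite (_ : W `&` dom c = W)//; apply/seteqP; split=> [x []//|x Wx].
by split=> //; exact/(nc_dom hU)/WU.
Qed.

Let img_sub W : W `<=` U -> img W `<=` img U.
Proof. by move=> WU _ [x Wx <-]; exists x => //; exact: WU. Qed.

Lemma open_nonzero W f : open W -> W `<=` U -> smooth (img W) f ->
  open [set y | W y /\ f (coord c y) != 0].
Proof.
move=> oW WU sf; have oI := open_img oW WU.
have -> : [set y | W y /\ f (coord c y) != 0] =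
    W `&` (dom c `&` coord c @^-1` [set z | img W z /\ f z != 0]).
  apply/seteqP; split=> [y [Wy fy]|y [Wy [_ [_ fy]]]]; last by split.
  by split=> //; split; [exact/(nc_dom hU)/WU|split=> //; exists y].
by apply: openI => //; apply: open_coord_preimage; exact: open_off oI sf.
Qed.

Let symg : symmetric_on (~` D) g := pe_sym hD.

Let img_field W X : W `<=` U -> vector_field W X -> smooth (img W) (X c \o param c).
Proof. by move=> WU; apply: vector_field_chart => x /WU; exact: (nc_dom hU). Qed.

Let speed (F : 'rV[R]_m -> 'rV[R]_m) : 'rV[R]_m -> R^o :=
  fun z => pairing (gradient sigma z) (F z).

Let smooth_speed W F : open W -> W `<=` U -> smooth (img W) F -> smooth (img W) (speed F).
Proof.
move=> oW WU sF; have oI := open_img oW WU; apply: smooth_pairing => //.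
by apply: smooth_gradient => //; exact: smooth_sub (img_sub WU) (nc_smooth_sigma hU).
Qed.

(** Off D, where [g] inverts [G], the smooth decomposition [Z = zeta N + G(eta)] is the same as
    [sigma g(Z, .) = zeta d sigma + sigma eta], which is what [beta_formula] needs. *)
Lemma chart_beta W Z X (zeta : 'rV[R]_m -> R^o) (eta : 'rV[R]_m -> 'rV[R]_m) :
  open W -> W `<=` U -> vector_field W Z -> vector_field W X ->
  smooth (img W) zeta -> smooth (img W) eta ->
  (forall y, W y -> ~ D y -> bil_fun g X Z c y = 0) ->
  (forall y, W y ->
    Z c y = zeta (coord c y) *: N (coord c y) + eta (coord c y) *m gs c y) ->
  (forall y, W y -> zeta (coord c y) != 0) ->
  (forall y, W y -> zeta (coord c y) * pairing (gradient sigma (coord c y)) (Z c y) +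
     sigma (coord c y) * pairing (eta (coord c y)) (Z c y) != 0) ->
  exists F : 'rV[R]_m -> R^o, [/\ smooth (img W) F,
    forall y, W y -> ~ D y -> bil_fun g Z Z c y != 0 /\
      F (coord c y) = dual_connection g nabla Z Z X c y / bil_fun g Z Z c y &
    forall y, W y -> D y -> F (coord c y) =
      pairing (eta (coord c y)) (X c y) / zeta (coord c y) / 2 +
      ('D_(X c y) (speed (Z c \o param c)) (coord c y) / speed (Z c \o param c) (coord c y) -
       'D_(X c y) zeta (coord c y) / zeta (coord c y)) / 2].
Proof.
move=> oW WU vZ vX szeta seta XZ hZ zeta0 q0; have oI := open_img oW WU.
have IU := img_sub WU; have Wd x : W x -> dom c x by move=> /WU; exact: (nc_dom hU).
have stau := smooth_sub IU (nc_smooth_det hU).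
have De z : img W z -> 'D_e (polar_det gs c) z != 0 by move=> /IU; exact: (nc_transverse hU).
have ssig := smooth_sub IU (nc_smooth_sigma hU).
have sZ := img_field WU vZ; have sX := img_field WU vX.
have offD x : W x -> polar_det gs c (coord c x) != 0 -> ~ D x.
  by move=> Wx tx Dx; move: tx; rewrite ((nc_polar hU (WU _ Wx)).1 Dx) eqxx.
have ZK Y x : W x -> (Y c \o param c) (coord c x) = Y c x by move=> Wx; rewrite /=
    coordK//; exact: Wd.
have sig0 z : img W z -> (sigma z = 0 <-> polar_det gs c z = 0).
  move=> [x Wx <-]; exact: iff_trans (nc_sigma0 hU (WU _ Wx)) (nc_polar hU (WU _ Wx)).
pose gh (z : 'rV[R]_m) := g c (param c z).
have ghE x : W x -> gh (coord c x) = g c x by move=> Wx; rewrite /gh coordK//; exact: Wd.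
have ghZ z : img W z -> polar_det gs c z != 0 ->
    sigma z *: ((Z c \o param c) z *m gh z) = zeta z *: gradient sigma z + sigma z *: eta z.
  move=> [x Wx <-] tx; rewrite ZK// ghE//.
  have [inv _] := dual_inverse hD (offD x Wx tx) (Wd x Wx).
  rewrite (hZ _ Wx) mulmxDl -(mulmxA (eta _)) inv mulmx1 scalerDr; congr (_ + _).
  rewrite -scalemxAl scalerA (mulrC (sigma _)) -scalerA; congr (_ *: _).
  by rewrite scalemxAl -(nc_gradient hU (WU _ Wx)) -mulmxA inv mulmx1.
have ZX0 z : img W z -> polar_det gs c z != 0 ->
    bil (gh z) ((Z c \o param c) z) ((X c \o param c) z) = 0.
  move=> [x Wx <-] tx; rewrite !ZK// ghE// (symg (offD x Wx tx) (Wd x Wx)).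
  exact: XZ Wx (offD x Wx tx).
have zz z : img W z -> zeta z != 0 by move=> [x Wx <-]; exact: zeta0.
have qq z : img W z -> zeta z * pairing (gradient sigma z) ((Z c \o param c) z) +
    sigma z * pairing (eta z) ((Z c \o param c) z) != 0.
  by move=> [x Wx <-]; rewrite ZK//; exact: q0.
have [sF [F1 F2]] := beta_formula oI stau De ssig szeta sZ sX seta sig0 ghZ ZX0 zz qq.
eexists; split; first exact: sF.
- move=> y Wy Dy; have ty : polar_det gs c (coord c y) != 0.
    by apply/eqP => /(nc_polar hU (WU _ Wy)).2.
  have [] := F1 (coord c y) (ex_intro2 _ _ y Wy erefl) ty.
  rewrite !ZK// ghE// => n0 E; split; first exact: n0.
  apply: (mulIf n0); rewrite divfK//; apply: etrans E _.
  (* The connection is that of [g] off D, so Koszul's formula is applied on [W] minus D. *)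
  have oWD : open (W `&` ~` D) by apply: openI => //; exact/closed_openC/(pe_closed hD).
  have sub : W `&` ~` D `<=` W by move=> x [].
  have subD : W `&` ~` D `<=` ~` D by move=> x [].
  have ZXf c' x : (W `&` ~` D) x -> dom c' x -> bil_fun g Z X c' x = 0.
    move=> [Wx Dx] dx'; have dx := Wd x Wx.
    have vZ' := vector_field_sub sub vZ; have vX' := vector_field_sub sub vX.
    have tg : tensor02 (W `&` ~` D) g.
      have [sg tg] := pe_tensor hD; split=> [a|a b z [_ Dz]]; last exact: tg.
      by apply: smooth_sub (sg a) => _ [z [[_ Dz] dz] <-]; exists z.
    rewrite (bil_fun_chart tg vZ' vX' (conj Wx Dx) dx dx') /bil_fun (symg Dx dx).
    exact: XZ Wx Dx.
  rewrite (koszul symg hnabla oWD subD (vector_field_sub sub vZ) (vector_field_sub sub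
      vX) ZXf (conj Wy Dy) (Wd _ Wy)).
  by [].
- move=> y Wy Dy; have ty := (nc_polar hU (WU _ Wy)).1 Dy.
  by rewrite (F2 (coord c y) (ex_intro2 _ _ y Wy erefl) ty) !(ZK X y Wy).
Qed.

(* The projection along [N] onto the kernel of [d sigma]. *)
Let tangential (F : 'rV[R]_m -> 'rV[R]_m) : 'rV[R]_m -> 'rV[R]_m :=
  fun z => F z - (speed F z / speed N z) *: N z.

Let speed_tangential F z : speed N z != 0 -> speed (tangential F) z = 0.
Proof.
by move=> s0; rewrite /speed /tangential pairingBr pairingZr -/(speed N z) divfK// subrr.
Qed.

Let smooth_tangential W F : open W -> W `<=` U ->
  (forall y, W y -> speed N (coord c y) != 0) ->
  smooth (img W) F -> smooth (img W) (tangential F).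
Proof.
move=> oW WU s0 sF; have oI := open_img oW WU.
have sN := smooth_sub (img_sub WU) (nc_smooth_normal hU).
apply: smoothD => //.
apply: (@smooth_eq _ _ _ _ (fun z => (- (speed F z / speed N z) : R^o) *: N z)) => //.
  by move=> z _; rewrite scaleNr.
apply: smoothZ => //; apply: smoothN => //; apply: smooth_div => //.
- by move=> _ [y Wy <-]; exact: s0.
- exact: smooth_speed.
- exact: smooth_speed.
Qed.

Let tangential_field W F : open W -> W `<=` U ->
  (forall y, W y -> speed N (coord c y) != 0) ->
  smooth (img W) F -> tangent_vector_field D W (field_of_chart c (tangential F)).
Proof.
move=> oW WU s0 sF; have Wd : W `<=` dom c by move=> x /WU; exact: (nc_dom hU).
have vX := vector_field_of_chart oW Wd (smooth_tangential oW WU s0 sF).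
split=> // c' x Wx Dx dx'; have dx := Wd x Wx.
rewrite (vX.2 c c' x Wx dx dx'); apply: (tangent_chart hD Dx dx dx').
apply: (nc_tangent hU _ (WU _ Wx) Dx).2.
by rewrite field_of_chartE//; exact: speed_tangential (s0 _ Wx).
Qed.

Let tangential_on F x : U x -> D x -> tangent_to D c x (F (coord c x)) ->
  tangential F (coord c x) = F (coord c x).
Proof.
move=> Ux Dx /(nc_tangent hU _ Ux Dx).1 t0.
by rewrite /tangential /speed t0 mul0r scale0r subr0.
Qed.

Let speedN x : U x -> D x -> speed N (coord c x) != 0.
Proof. by move=> Ux Dx; rewrite /speed (nc_normal1 hU)// oner_neq0. Qed.

(** [N sigma = 1] is known only on D; [U1] is the neighbourhood of the polar points of [U] on which
    [tangential] is defined without dividing by zero. *)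
Let U1 := [set y | U y /\ speed N (coord c y) != 0].

Let open_U1 : open U1.
Proof.
have oU := nc_open hU; apply: open_nonzero => //.
by apply: smooth_speed => //; exact: (nc_smooth_normal hU).
Qed.

Lemma polar_normal_chart : polar_normal D g nabla U (field_of_chart c N).
Proof.
have oU := nc_open hU; have Ud := nc_dom hU.
have vN := vector_field_of_chart oU Ud (nc_smooth_normal hU).
split=> //.
  move=> c' x Ux Dx dx' tN; have dx := Ud _ Ux.
  have := tangent_chart hD Dx dx' dx tN.
  rewrite -(vN.2 c' c x Ux dx' dx) => /(nc_tangent hU _ Ux Dx).1.
  by rewrite field_of_chartE// (nc_normal1 hU)// => /eqP; rewrite oner_eq0.
move=> V [tV eV] x Ux Dx; have [W0 [X0 [oW0 W0x W0U vX0 VX]]] := eV x Ux Dx.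
pose W := W0 `&` U1; have oW : open W by apply: openI.
have WU : W `<=` U by move=> y [/W0U].
have WW0 : W `<=` W0 by move=> y [].
have Wx : W x by split=> //; split=> //; exact: speedN.
have Ws y : W y -> speed N (coord c y) != 0 by move=> [_ []].
have sX0 := img_field WU (vector_field_sub WW0 vX0).
(* Projecting the given extension [X0] of [V] makes [X sigma = 0] on all of [W]. This yields
   [g(X, N) = 0] off D, because [sigma g(N, .) = d sigma], and it leaves [X0] unchanged on D. *)
pose X := field_of_chart c (tangential (X0 c \o param c)).
have tX : tangent_vector_field D W X by exact: tangential_field.
have vX := tX.1; have vNW := vector_field_sub WU vN.
have Wd y : W y -> dom c y by move=> /WU /Ud.
have sgX y : W y -> pairing (gradient sigma (coord c y)) (X c y) = 0.
  by move=> Wy; rewrite /X field_of_chartE; [exact: speed_tangential (Ws _ Wy)|exact: Wd].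
have NE y : W y -> field_of_chart c N c y = N (coord c y).
  by move=> Wy; apply: field_of_chartE; exact: Wd.
have XN y : W y -> ~ D y -> bil_fun g X (field_of_chart c N) c y = 0.
  move=> Wy Dy; rewrite /bil_fun (symg Dy (Wd _ Wy)) NE//.
  have sy : sigma (coord c y) != 0 by apply/eqP => /(nc_sigma0 hU (WU _ Wy)).1.
  have [inv _] := dual_inverse hD Dy (Wd y Wy).
  apply: (mulfI sy); rewrite mulr0 bil_pairing -pairingZl scalemxAl.
  by rewrite -(nc_gradient hU (WU _ Wy)) -mulmxA inv mulmx1 sgX.
have s1 : smooth (img W) (fun=> 1 : R^o) by exact: smooth_cst.
have s0 : smooth (img W) (fun=> 0 : 'rV[R]_m) by exact: smooth_cst.
have [||| F [sF F1 F2]] := chart_beta oW WU vNW vX s1 s0 XN.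
- by move=> y Wy; rewrite NE// scale1r mul0mx addr0.
- by move=> y Wy; exact: oner_neq0.
- by move=> y Wy; rewrite NE// pairing0l mulr0 addr0 mul1r; exact: Ws.
have WD : W `&` ~` D `<=` ~` D by move=> y [].
have oWD : open (W `&` ~` D) by apply: openI => //; exact/closed_openC/(pe_closed hD).
have subW : W `&` ~` D `<=` W by move=> y [].
have tg : tensor02 (W `&` ~` D) g.
  have [sg tg] := pe_tensor hD; split=> [a|a b z [_ Dz]]; last exact: tg.
  by apply: smooth_sub (sg a) => _ [z [[_ Dz] dz] <-]; exists z.
have vNWD := vector_field_sub subW vNW; have vXD := vector_field_sub subW vX.
have vnab := lc_field hnabla oWD WD vNWD vNWD.
exists W, X, (fun y => F (coord c y)); split; first by split.
split.
- move=> c' y [Wy Dy] dy'; have dy := Wd _ Wy.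
  have VXy : V c y = X0 c y by apply: VX => //; split=> //; exact: WW0.
  have EX : X c y = X0 c y.
    rewrite /X field_of_chartE// tangential_on ?/comp ?coordK//; first exact: WU.
    by rewrite -VXy; apply: tV => //; exact: WU.
  have -> : V c' y = X0 c' y by apply: VX => //; split=> //; exact: WW0.
  by rewrite (vX.2 c c' y Wy dy dy') (vX0.2 c c' y (WW0 _ Wy) dy dy') EX.
- move=> c' y Wy Dy dy'.
  by rewrite (bil_fun_chart tg vXD vNWD (conj Wy Dy) (Wd _ Wy) dy') XN.
- move=> c' y Wy Dy dy'; have dy := Wd _ Wy; have [n0 FE] := F1 y Wy Dy.
  rewrite /dual_connection (bil_fun_chart tg vNWD vNWD (conj Wy Dy) dy dy').
  by rewrite (bil_fun_chart tg vnab vXD (conj Wy Dy) dy dy').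
- by apply: smooth_fun_of_chart => // y; exact: Wd.
rewrite F2// pairing0l mul0r mul0r add0r.
have -> : 'D_(X c x) (fun=> 1 : R^o) (coord c x) = 0 by exact: derive_cst.
rewrite mul0r subr0.
have oI := open_img oW WU; have IU := img_sub WU.
have stau := smooth_sub IU (nc_smooth_det hU).
have De z : img W z -> 'D_e (polar_det gs c) z != 0 by move=> /IU; exact: (nc_transverse hU).
have dx := Wd _ Wx; have Ix : img W (coord c x) by exists x.
have tauX : 'D_(X c x) (polar_det gs c) (coord c x) = 0.
  apply: (tangent_derive dx (smooth_differentiable stau Ix) (D := D)); last exact: tX.2.
  move=> y dy Dy; have ne : (dom c `&` D) !=set0 by exists x.
  by have := (polar_set hD dy ne).1 Dy; rewrite /polar_det coordK.
have sS := smooth_speed oW WU (img_field WU vNW).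
(* With [zeta = 1] and [eta = 0] only the derivative of [N sigma] along [X] remains. As
   [N sigma - 1] vanishes on D, its derivative is a multiple of that of [tau], which is zero along
   the tangent vector [X]. *)
pose w z : R^o := speed (field_of_chart c N c \o param c) z - 1.
have sw : smooth (img W) w by apply: smoothB.
have w0 z : img W z -> polar_det gs c z = 0 -> w z = 0.
  move=> [y Wy <-] ty; have Dy := (nc_polar hU (WU _ Wy)).2 ty.
  by rewrite /w /speed /comp coordK ?NE ?(nc_normal1 hU) ?subrr//; [exact: WU|exact: Wd].
have := vanish_derive oI stau De (X c x) sw w0 Ix ((nc_polar hU Ux).1 Dx).
rewrite tauX mul0r (derive_sub _ (smooth_differentiable sS Ix) (smooth_differentiable s1 Ix)).
have -> : 'D_(X c x) (fun=> 1 : R^o) (coord c x) = 0 by exact: derive_cst.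
by rewrite subr0 => ->; rewrite mul0r mul0r.
Qed.

Lemma polar_normal_unique Z x : polar_normal D g nabla U Z -> U x -> D x ->
  exists lambda : R, forall c', dom c' x ->
    Z c' x = lambda *: field_of_chart c N c' x.
Proof.
move=> [vZ trZ bZ] Ux Dx; have oU := nc_open hU; have Ud := nc_dom hU.
have UU : U `<=` U by [].
have oI := open_img oU UU; have dx := Ud _ Ux.
have sZ := img_field UU vZ; have sN := nc_smooth_normal hU.
pose s := speed (Z c \o param c).
have ss : smooth (img U) s by exact: smooth_speed.
(* Since [N sigma = 1] on D, subtracting [(Z sigma) N] leaves a field tangent to D, which can be
   divided by [G]. *)
pose T (z : 'rV[R]_m) := (Z c \o param c) z + (- s z : R^o) *: N z.
have sT : smooth (img U) T.
  by apply: smoothD => //; apply: smoothZ => //; exact: smoothN.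
have T0 y : img U (coord c y) -> U y -> D y ->
    pairing (gradient sigma (coord c y)) (T (coord c y)) = 0.
  by move=> _ Uy Dy; rewrite pairingDr pairingZr (nc_normal1 hU)// mulr1 subrr.
have [eta seta TE] := nc_divide hU oI (fun z h => h) sT T0.
have ZE y : U y -> Z c y = s (coord c y) *: N (coord c y) + eta (coord c y) *m gs c y.
  move=> Uy; have Iy : img U (coord c y) by exists y.
  have := TE _ Iy; rewrite /T /comp coordK; last exact: Ud.
  by move=> <-; rewrite scaleNr addrC subrK.
have sx : s (coord c x) != 0.
  apply/eqP => s0; apply: (trZ c x Ux Dx dx); apply: (nc_tangent hU _ Ux Dx).2.
  by move: s0; rewrite /s /speed /comp coordK.
have sig0 : sigma (coord c x) = 0 by exact: (nc_sigma0 hU Ux).2.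
(* [beta_Z] is tested on a tangent field with value [v] at [x]. For [zeta = s = Z sigma] the two
   logarithmic derivatives in [chart_beta] cancel, leaving [eta(v) / (2 s)]. *)
have eta0 v : pairing (gradient sigma (coord c x)) v = 0 -> pairing (eta (coord c x)) v = 0.
  move=> gv; have U1U : U1 `<=` U by move=> y [].
  have sv : smooth (img U1) (fun=> v) by exact: smooth_cst.
  have tV := tangential_field open_U1 U1U (fun y h => h.2) sv.
  pose V := field_of_chart c (tangential (fun=> v)).
  have hV : hypersurface_vector_field D U V.
    split=> [c' y Uy Dy dy|y Uy Dy].
      by apply: tV.2 => //; split=> //; exact: speedN.
    exists U1, V; split; [exact: open_U1| |exact: U1U|exact: tV.1|by move=> c' z _ _].
    by split=> //; exact: speedN.
  have [W0 [X [F [[oW0 W0x W0U tX] [XV XZ FE sF F0]]]]] := bZ V hV x Ux Dx.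
  pose q z : R^o := s z * pairing (gradient sigma z) ((Z c \o param c) z) +
    sigma z * pairing (eta z) ((Z c \o param c) z).
  have sq : smooth (img U) q.
    apply: smoothD => //; first exact: smoothM.
    by apply: smoothM => //; [exact: (nc_smooth_sigma hU)|exact: smooth_pairing].
  (* This set contains [x], because there [sigma = 0] and so [q = s^2]. *)
  pose W := W0 `&` ([set y | U y /\ s (coord c y) != 0] `&` [set y | U y /\ q (coord c
      y) != 0]).
  have oW : open W by apply: openI => //; apply: openI; exact: open_nonzero.
  have WU : W `<=` U by move=> y [/W0U].
  have WW0 : W `<=` W0 by move=> y [].
  have IWU := img_sub WU; have oIW := open_img oW WU.
  have Wx : W x.
    split=> //; split; split=> //; rewrite /q sig0 mul0r addr0.
    exact: (mulf_neq0 sx sx).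
  have Wd y : W y -> dom c y by move=> /WU/Ud.
  have XZ' y : W y -> ~ D y -> bil_fun g X Z c y = 0.
    by move=> Wy Dy; apply: XZ => //; [exact: WW0|exact: Wd].
  have q0 y : W y -> s (coord c y) * pairing (gradient sigma (coord c y)) (Z c y) +
      sigma (coord c y) * pairing (eta (coord c y)) (Z c y) != 0.
    by move=> Wy; have [_ [_ [_]]] := Wy; rewrite /q /comp coordK//; exact: Wd.
  have [F' [sF' F'1 F'2]] := chart_beta oW WU (vector_field_sub WU vZ)
    (vector_field_sub WW0 tX.1) (smooth_sub IWU ss) (smooth_sub IWU seta) XZ'
    (fun y Wy => ZE y (WU _ Wy)) (fun y Wy => Wy.2.1.2) q0.
  have sFc : smooth (img W) (F \o param c : _ -> R^o).
    by apply: smooth_sub (sF c) => _ [y Wy <-]; exists y => //; split; [exact: WW0|exact: Wd].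
  (* The extension [F] supplied by the hypothesis and the explicit [F'] agree off D, hence at [x] by
     density. *)
  have EF : (F \o param c) (coord c x) = F' (coord c x).
    apply: (dense_off_eq oIW (smooth_sub IWU (nc_smooth_det hU))
      (fun z Wz => nc_transverse hU (IWU z Wz)) sFc sF'); last by exists x.
    move=> _ [y Wy <-] ty; have Dy : ~ D y by move=> /(nc_polar hU (WU _ Wy)).1/eqP; apply/negP.
    rewrite /comp coordK; last exact: Wd.
    by rewrite (F'1 y Wy Dy).2 (FE c y (WW0 _ Wy) Dy (Wd _ Wy)).2.
  have VX : X c x = v.
    rewrite XV//; rewrite /V field_of_chartE// tangential_on//.
    exact: (nc_tangent hU _ Ux Dx).2.
  move: EF; rewrite (F'2 x Wx Dx) /comp coordK// F0 VX subrr mul0r addr0 => /esym/eqP.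
  rewrite !mulf_eq0 !invr_eq0 (negbTE sx) pnatr_eq0 !orbF => /eqP.
  exact.
(* Each [G(u)] is tangent to D at [x], as [d sigma G = sigma N = 0] there. So [eta] kills it and, by
   symmetry of [G], [eta] lies in the radical. *)
have Tx : eta (coord c x) *m gs c x = 0.
  apply: pairing_eq0 => u; rewrite pairing_mulmx (nc_sym hU Ux); apply: eta0.
  rewrite -(nc_sym hU Ux) -pairing_mulmx (nc_gradient hU Ux) sig0 scale0r.
  exact: pairing0l.
exists (s (coord c x)) => c' dx'.
by rewrite (vZ.2 c c' x Ux dx dx') (ZE x Ux) Tx addr0 scalemxAl.
Qed.

End InNormalChart.

Theorem theorem8 (R : realType) (m : nat) (hm : (2 <= m)%N) (M : manifold R m)
    (D : set M) (g gs : bfield M) (nabla : vfield M -> vfield M -> vfield M)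
    (hD : polar_end D g gs) (hnabla : levi_civita (~` D) g nabla) :
  forall p : M, D p ->
  exists U : set M, [/\ open U, U p &
    exists N : vfield M, polar_normal D g nabla U N /\
      forall N' : vfield M, polar_normal D g nabla U N' ->
        forall x : M, U x -> D x ->
          exists lambda : R, forall c : chart M, dom c x ->
            N' c x = lambda *: N c x].
Proof.
move=> p Dp; have [c [U [e [sigma [N [hU Up]]]]]] := normal_chart_exists hD Dp.
exists U; split; [exact: nc_open hU|exact: Up|].
exists (field_of_chart c N); split; first exact: (polar_normal_chart hD hnabla hU).
by move=> N' hN' x Ux Dx; exact: (polar_normal_unique hD hnabla hU hN' Ux Dx).
Qed.
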